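(* In the sector with $n_F=1$ fermion of the $SU(3)$ model, exact continuum (infinite cut-off) solutions of $H|E\rangle=E|E\rangle$ are obtained from the finite cut-off solutions by simply extending the sums over $n$ to infinity. That is, with $C_1=(f^\dagger a^\dagger)$, $C_2=(f^\dagger a^\dagger a^\dagger)$ and $\kappa\ge0$ an integer, the finite cut-off solutions $$(2E)^{3\kappa+\frac12}e^{-E}\sum_{n}L_n^{6\kappa+4}(2E)\Big\{C_1|n,2\kappa\rangle+\sum_{p=1}^{\kappa}\Big(\Gamma^{odd}_{2\kappa,2\kappa-2p+1}C_2|n+3p-2,2\kappa-2p+1\rangle+\Gamma^{odd}_{2\kappa,2\kappa-2p}C_1|n+3p,2\kappa-2p\rangle\Big)\Big\},$$ $$(2E)^{3\kappa+\frac52}e^{-E}\sum_{n}L_n^{6\kappa+8}(2E)\Big\{C_2|n,2\kappa+1\rangle+\sum_{p=1}^{\kappa}\Big(\Gamma^{odd}_{2\kappa+1,2\kappa-2p+2}C_1|n+3p-1,2\kappa-2p+2\rangle+\Gamma^{odd}_{2\kappa+1,2\kappa-2p+1}C_2|n+3p,2\kappa-2p+1\rangle\Big)\Big\},$$ $$(2E)^{3\kappa+2}e^{-E}\sum_{n}L_n^{6\kappa+7}(2E)\Big\{C_1|n,2\kappa+1\rangle+\sum_{p=1}^{\kappa}\Big(\Gamma^{even}_{2\kappa+1,2\kappa-2p}C_2|n+3p+1,2\kappa-2p\rangle+\Gamma^{even}_{2\kappa+1,2\kappa-2p+1}C_1|n+3p,2\kappa-2p+1\rangle\Big)\Big\},$$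 $$(2E)^{3\kappa+1}e^{-E}\sum_{n}L_n^{6\kappa+5}(2E)\Big\{C_2|n,2\kappa\rangle+\sum_{p=1}^{\kappa}\Big(\Gamma^{even}_{2\kappa,2\kappa-2p+1}C_1|n+3p-1,2\kappa-2p+1\rangle+\Gamma^{even}_{2\kappa,2\kappa-2p}C_2|n+3p,2\kappa-2p\rangle\Big)\Big\},$$ in which at finite cut-off $n$ runs over a finite range starting at $0$, become continuum solutions when the sum over $n$ is taken over all $n\ge0$. In particular, the two simplest families (no mixing) become $$|E,0,1\rangle_{odd}=(2E)^{\frac12}e^{-E}\sum_{n=0}^\infty L_n^4(2E)\,C_1|n,0\rangle,\qquad |E,0,2\rangle_{even}=(2E)e^{-E}\sum_{n=0}^\infty L_n^5(2E)\,C_2|n,0\rangle.$$ In the continuum limit the energy quantization conditions allow energies $E$ lying on the whole real positive axis.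
   Context: Model. Let $T^A$, $A=1,\dots,8$, be the generators of $SU(3)$ in the fundamental representation, $\mathrm{tr}(T^AT^B)=\frac12\delta_{AB}$; $[a_A,a_B^\dagger]=\delta_{AB}$, $\{f_A,f_B^\dagger\}=\delta_{AB}$, bosonic and fermionic operators commuting; $a=\sum_Aa_AT^A$, $a^\dagger=\sum_Aa_A^\dagger T^A$, $f^\dagger=\sum_Af_A^\dagger T^A$; $(O)$ denotes the trace of a product of such matrices; $|0\rangle$ is the Fock vacuum; $H=(a^\dagger a)+2-\frac12(a^\dagger a^\dagger)-\frac12(aa)$; $|j,k\rangle=(a^\dagger a^\dagger)^j(a^\dagger a^\dagger a^\dagger)^k|0\rangle$. Eigenvalue equation. For a state $\sum a^1_{j,k}C_1|j,k\rangle+\sum a^2_{j,k}C_2|j,k\rangle$ it reads, coefficientwise, $$a^1_{j-1,k}-(2j+3k+5-2E)a^1_{j,k}+(j+1)(j+3k+5)a^1_{j+1,k}+\tfrac38(k+1)(k+2)a^1_{j-2,k+2}+\tfrac{k+1}2a^2_{j-1,k+1}=0,$$ $$a^2_{j-1,k}-(2j+3k+6-2E)a^2_{j,k}+(j+1)(j+3k+6)a^2_{j+1,k}+\tfrac38(k+1)(k+2)a^2_{j-2,k+2}+\tfrac{3(k+1)}2a^1_{j,k+1}=0,$$ with coefficients having a negative index equal to zero. At finite cut-off $N$ (at most $N$ bosonic quanta) the sums over $n$ in the four families run from $0$ to $d-1$ with $d=\lfloor\frac12(N-6\kappa-b)\rfloor+1$, $b=1,5,4,2$ respectively, and $E$ is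 restricted by the quantization condition $L_d^{\alpha}(2E)=0$ with $\alpha=6\kappa+4,\,6\kappa+8,\,6\kappa+7,\,6\kappa+5$ respectively. Rescaled Laguerre polynomials: $L_n^\alpha(x)=\mathcal L_n^\alpha(x)/\Gamma(n+\alpha+1)$, with $\mathcal L_n^\alpha$ the generalized Laguerre polynomial, i.e. $L_n^\alpha(x)=\sum_{i=0}^n\frac{(-x)^i}{i!\,(n-i)!\,\Gamma(\alpha+i+1)}$. Mixing constants. Let $\mu_t=-\frac38(t+1)(t+2)$. Even case: $\alpha_t=3t+4$, $\chi_t=-\frac12(t+1)$ for $t$ odd; $\alpha_t=3t+5$, $\chi_t=-\frac32(t+1)$ for $t$ even. Odd case: $\alpha_t=3t+4$, $\chi_t=-\frac12(t+1)$ for $t$ even; $\alpha_t=3t+5$, $\chi_t=-\frac32(t+1)$ for $t$ odd. In each case, for a top index $m$, set $\gamma_y\equiv1$ for $y\ge m$ and define recursively $$\gamma_{m-1}=\frac{4\chi_{m-1}}{\alpha_m^2-\alpha_{m-1}^2},\qquad \gamma_y=\frac{4(\chi_y\gamma_{y+1}+\mu_y\gamma_{y+2})}{\alpha_m^2-\alpha_y^2}\quad(0\le y\le m-2)$$ (the equation with index $m-1$ of the underlying coupled system has no $\mu$-term). $\Gamma^{even}_{m,y}$ (resp. $\Gamma^{odd}_{m,y}$) denotes $\gamma_y$ computed with top index $m$ from the even-case (resp. odd-case) data.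
   Formalization: As displayed, families 2 and 3 do not solve the eigenvalue equation (already at κ=0); the formal theorem adds the missing state Γ^odd_{2κ+1,0} C_1|n+3κ+2,0⟩ to family 2 and Γ^even_{2κ+1,2κ} C_2|n+1,2κ⟩ to family 3. *)

(* Defs.v *)
From HB Require Import structures.
From mathcomp Require Import all_boot all_order all_algebra.
From mathcomp Require Import boolp functions reals sequences exp.
From mathcomp Require Import complex ring.

Set Implicit Arguments.
Unset Strict Implicit.
Unset Printing Implicit Defensive.

Import Order.TTheory GRing.Theory Num.Theory.
Local Open Scope ring_scope.

(* T is an orthogonal basis of the Lie algebra of SU(3) in its defining
   representation, normalised by tr (T^A T^B) = delta_AB / 2; the Gell-Mann
   matrices divided by 2 are an instance. *)
Definition su3_generators (R : realType) (T : 'I_8 -> 'M[R[i]]_3) : Prop :=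
  [/\ forall A, map_mx Num.conj (T A)^T = T A,
      forall A, \tr (T A) = 0 &
      forall A B, \tr (T A *m T B) = (A == B)%:R / 2].

(* An occupation basis vector |n; F> of the Fock space: n A is the number of
   bosonic quanta of colour A, and F is the set of colours A for which the
   fermionic mode A is filled. *)
Definition occ := ({ffun 'I_8 -> nat} * {set 'I_8})%type.

Definition quanta (s : occ) : nat := (\sum_A s.1 A)%N.

(* A state is the family of its amplitudes on the orthonormal occupation basis.
   No finiteness or square-summability is required, so that the space contains
   the non-normalisable continuum states.  Every amplitude of the image of a
   state under a_A, a_A^dagger, f_A, f_A^dagger involves one amplitude of that
   state only, so that these operators act on all such families. *)
Definition state (R : realType) := occ -> R[i].

Definition operator (R : realType) := state R -> state R.

Definition incr (A : 'I_8) (n : {ffun 'I_8 -> nat}) : {ffun 'I_8 -> nat} :=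
  [ffun B => (n B + (B == A))%N].

Definition decr (A : 'I_8) (n : {ffun 'I_8 -> nat}) : {ffun 'I_8 -> nat} :=
  [ffun B => (n B - (B == A))%N].

(* a_A |n> = sqrt (n A) |decr A n>, read on amplitudes. *)
Definition boson (R : realType) (A : 'I_8) : operator R :=
  fun psi s => sqrtC (s.1 A).+1%:R * psi (incr A s.1, s.2).

(* a_A^dagger |n> = sqrt (n A + 1) |incr A n>, read on amplitudes; the
   prefactor vanishes when n A = 0. *)
Definition bosonD (R : realType) (A : 'I_8) : operator R :=
  fun psi s => sqrtC (s.1 A)%:R * psi (decr A s.1, s.2).

(* The usual sign of the ordered product of fermionic creation operators. *)
Definition fsign (R : realType) (A : 'I_8) (F : {set 'I_8}) : R[i] :=
  (-1) ^+ #|[set B in F | (B < A)%N]|.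

Definition fermion (R : realType) (A : 'I_8) : operator R :=
  fun psi s =>
    if A \in s.2 then 0 else fsign R A s.2 * psi (s.1, A |: s.2).

Definition fermionD (R : realType) (A : 'I_8) : operator R :=
  fun psi s =>
    if A \in s.2 then fsign R A s.2 * psi (s.1, s.2 :\ A) else 0.

Definition vac (R : realType) : state R :=
  fun s => (s == ([ffun=> 0%N], finset.set0) :> occ)%:R.

Lemma boson_vac (R : realType) (A : 'I_8) : boson A (vac R) = 0.
Proof.
apply/funext => -[n F]; rewrite /boson /vac /=.
case: eqP => [[/ffunP/(_ A) + _]|_]; last by rewrite mulr0.
by rewrite !ffunE eqxx addn1.
Qed.

Lemma fermion_vac (R : realType) (A : 'I_8) : fermion A (vac R) = 0.
Proof.
apply/funext => -[n F]; rewrite /fermion /vac /=; case: ifP => // _.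
case: eqP => [[_ /setP/(_ A)]|_]; last by rewrite mulr0.
by rewrite !inE eqxx.
Qed.

Lemma boson_ccr (R : realType) (A B : 'I_8) (psi : state R) :
  boson A (bosonD B psi) - bosonD B (boson A psi) = (A == B)%:R *: psi.
Proof.
apply/funext => -[n F].
rewrite !fctE /boson /bosonD /= !ffunE eq_sym.
have [->|neq] := eqVneq A B; last first.
  rewrite addn0 subn0 scale0r mulrCA; apply/eqP; rewrite subr_eq0; apply/eqP.
  case: (posnP (n B)) => [->|nB]; first by rewrite sqrtC0 !mul0r.
  congr (_ * (_ * psi (_, _))); apply/ffunP => C; rewrite !ffunE.
  case: (eqVneq C B) => [->|]; last by rewrite !subn0.
  by rewrite eq_sym (negbTE neq) !addn0.
have decrK : decr B (incr B n) = n by apply/ffunP => C; rewrite !ffunE addnK.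
rewrite addn1 decrK mulrA -expr2 sqrtCK scale1r.
case: (posnP (n B)) => [nB|nB].
  by rewrite nB sqrtC0 mul0r subr0 mul1r.
have -> : incr B (decr B n) = n.
  apply/ffunP => C; rewrite !ffunE subnK //.
  by case: eqP => // ->.
rewrite subn1 prednK // mulrA -expr2 sqrtCK -mulrBl -natrB // subSnn.
by rewrite mul1r.
Qed.

Lemma fsignU1 (R : realType) (A B : 'I_8) (F : {set 'I_8}) :
  B \notin F -> fsign R A (B |: F) = (-1) ^+ (B < A)%N * fsign R A F.
Proof.
move=> BF; rewrite /fsign -exprD; congr (_ ^+ _).
case: (boolP (B < A)%N) => BA /=.
  rewrite (_ : finset _ = B |: [set C in F | (C < A)%N]); last first.
    by apply/setP => C; rewrite !inE; case: (eqVneq C B) => [->|] //=; rewrite BA.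
  by rewrite cardsU1 !inE (negbTE BF).
rewrite add0n; apply: eq_card => C; rewrite !inE.
by case: (eqVneq C B) => [->|] //=; rewrite (negbTE BA) (negbTE BF).
Qed.

Lemma fermion_car (R : realType) (A B : 'I_8) (psi : state R) :
  fermion A (fermionD B psi) + fermionD B (fermion A psi) = (A == B)%:R *: psi.
Proof.
apply/funext => -[n F]; rewrite !fctE /fermion /fermionD /=.
have sq C G : fsign R C G * fsign R C G = 1 by rewrite -expr2 sqrr_sign.
have [<-|neq] := eqVneq A B.
  rewrite scale1r !inE !eqxx /=; case: (boolP (A \in F)) => AF.
    rewrite add0r finset.setD1K // mulrA.
    rewrite -{1}(finset.setD1K AF) fsignU1 ?inE ?eqxx // ltnn.
    by rewrite mul1r sq mul1r.
  by rewrite addr0 setU1K // fsignU1 // ltnn mul1r mulrA sq mul1r.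
rewrite scale0r !inE (negbTE neq) eq_sym (negbTE neq) /=.
case: (boolP (A \in F)) => AF; case: (boolP (B \in F)) => BF;
  rewrite ?mulr0 ?addr0 //.
rewrite fsignU1 //.
have -> : (A |: F) :\ B = A |: (F :\ B).
  apply/setP => C; rewrite !inE.
  by case: (eqVneq C A) => [->|]; case: (eqVneq _ B) neq => //= ->.
rewrite -{1}(finset.setD1K BF) fsignU1 ?inE ?eqxx //.
rewrite !mulrA -mulrDl; set x := fsign _ _ _; set y := fsign _ _ _.
suff -> : (-1) ^+ (B < A)%N * x * (-1) ^+ (A < B)%N * y + y * x = 0
  by rewrite mul0r.
have: (B < A)%N (+) (A < B)%N.
  by case: (ltngtP A B) => // /val_inj AB; rewrite AB eqxx in neq.
case: (B < A)%N; case: (A < B)%N => //= _; rewrite ?expr0 ?expr1; ring.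
Qed.

(* The matrix sum_A x_A T^A, whose entries are operators. *)
Definition opmx (R : realType) (T : 'I_8 -> 'M[R[i]]_3)
    (x : 'I_8 -> operator R) : 'I_3 -> 'I_3 -> operator R :=
  fun i j psi => \sum_A T A i j *: x A psi.

(* Traces of products of matrices with operator entries; the order of the
   operators is that of the matrices. *)
Definition tr2 (R : realType) (X Y : 'I_3 -> 'I_3 -> operator R) : operator R :=
  fun psi => \sum_i \sum_j X i j (Y j i psi).

Definition tr3 (R : realType) (X Y Z : 'I_3 -> 'I_3 -> operator R) :
    operator R :=
  fun psi => \sum_i \sum_j \sum_k X i j (Y j k (Z k i psi)).

Section Model.
Variables (R : realType) (T : 'I_8 -> 'M[R[i]]_3).

Let a := opmx T (@boson R).
Let aD := opmx T (@bosonD R).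
Let fD := opmx T (@fermionD R).

Definition hamiltonian : operator R := fun psi =>
  tr2 aD a psi + 2 *: psi - 2^-1 *: tr2 aD aD psi - 2^-1 *: tr2 a a psi.

Definition ket (j k : nat) : state R :=
  iter j (tr2 aD aD) (iter k (tr3 aD aD aD) (vac R)).

Definition C1 : operator R := tr2 fD aD.

Definition C2 : operator R := tr3 fD aD aD.

End Model.

Definition fermion_number (R : realType) : operator R :=
  fun psi => \sum_A fermionD A (fermion A psi).

Definition cutoff_proj (R : realType) (N : nat) : operator R :=
  fun psi s => if (quanta s <= N)%N then psi s else 0.

Definition cutoff_hamiltonian (R : realType) (T : 'I_8 -> 'M[R[i]]_3)
    (N : nat) : operator R :=
  cutoff_proj N \o hamiltonian T \o cutoff_proj N.

Definition eigenstate (R : realType) (O : operator R) (E : R) (psi : state R) :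
    Prop :=
  psi <> 0 /\ O psi = E%:C%C *: psi.

(* psi = sum_(n >= 0) phi n, as a sum that is locally finite: on every
   occupation basis vector the partial sums are eventually constant. *)
Definition sums_to (R : realType) (phi : nat -> state R) (psi : state R) :
    Prop :=
  forall s, exists M0 : nat,
    forall M : nat, (M0 <= M)%N -> (\sum_(n < M) phi n) s = psi s.

(* The rescaled Laguerre polynomial L_n^alpha / Gamma (n + alpha + 1); for a
   natural number alpha, Gamma (alpha + i + 1) is (alpha + i)!. *)
Definition laguerre (R : realType) (alpha n : nat) (x : R) : R :=
  \sum_(i < n.+1) (- x) ^+ i / (i`! * (n - i)`! * (alpha + i)`!)%:R.

Inductive parity := Even | Odd.

(* The indices t whose alpha_t and chi_t come from the equation for the
   coefficients of C1. *)
Definition c1_index (c : parity) (t : nat) : bool :=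
  match c with Even => odd t | Odd => ~~ odd t end.

Definition mix_alpha (c : parity) (t : nat) : nat :=
  if c1_index c t then (3 * t + 4)%N else (3 * t + 5)%N.

Definition mix_chi (R : realType) (c : parity) (t : nat) : R :=
  if c1_index c t then - (1 / 2) * t.+1%:R else - (3 / 2) * t.+1%:R.

Definition mix_mu (R : realType) (t : nat) : R :=
  - (3 / 8) * t.+1%:R * t.+2%:R.

Definition mix_den (R : realType) (c : parity) (m y : nat) : R :=
  (mix_alpha c m)%:R ^+ 2 - (mix_alpha c y)%:R ^+ 2.

(* gamma_(m - s), by recursion on the distance s to the top index m. *)
Fixpoint mix_rec (R : realType) (c : parity) (m s : nat) : R :=
  match s with
  | 0 => 1
  | s1.+1 =>
      let y := (m - s)%N in
      match s1 with
      | 0 => 4 * mix_chi R c y / mix_den R c m y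
      | s2.+1 =>
          4 * (mix_chi R c y * mix_rec R c m s1 + mix_mu R y * mix_rec R c m s2)
            / mix_den R c m y
      end
  end.

Definition Gamma (R : realType) (c : parity) (m y : nat) : R :=
  mix_rec R c m (m - y).

(* The four families, named after the parity of the number of bosonic quanta
   and the operator in the unmixed term. *)
Inductive sol_family := OddC1 | OddC2 | EvenC1 | EvenC2.

Definition offset (fam : sol_family) : nat :=
  match fam with OddC1 => 1 | OddC2 => 5 | EvenC1 => 4 | EvenC2 => 2 end.

Definition lag_index (fam : sol_family) (kappa : nat) : nat :=
  match fam with
  | OddC1 => 6 * kappa + 4
  | OddC2 => 6 * kappa + 8
  | EvenC1 => 6 * kappa + 7
  | EvenC2 => 6 * kappa + 5
  end.

Definition prefactor (R : realType) (fam : sol_family) (kappa : nat) (E : R) : R :=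
  let p : R := match fam with
    | OddC1 => 1 / 2 | OddC2 => 5 / 2 | EvenC1 => 2 | EvenC2 => 1 end in
  (2 * E) `^ (3 * kappa%:R + p) * expR (- E).

(* The combination of states multiplied by L_n (2 E).  For OddC2 the mixing
   chain descends to the state C1 |n + 3 kappa + 2, 0>, and for EvenC1 it starts
   with C2 |n + 1, 2 kappa>; these two states are written separately because
   they have no partner in the sum over p.  Without them the combination does
   not satisfy the eigenvalue equation. *)
Definition mode (R : realType) (T : 'I_8 -> 'M[R[i]]_3) (fam : sol_family)
    (kappa n : nat) : state R :=
  let k2 := (2 * kappa)%N in
  let G c m y := (Gamma R c m y)%:C%C in
  match fam with
  | OddC1 =>
      C1 T (ket T n k2) +
      \sum_(1 <= p < kappa.+1)
        (G Odd k2 (k2 - 2 * p).+1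
           *: C2 T (ket T (n + 3 * p - 2) (k2 - 2 * p).+1) +
         G Odd k2 (k2 - 2 * p)%N
           *: C1 T (ket T (n + 3 * p) (k2 - 2 * p)))
  | OddC2 =>
      C2 T (ket T n k2.+1) +
      \sum_(1 <= p < kappa.+1)
        (G Odd k2.+1 (k2 - 2 * p).+2
           *: C1 T (ket T (n + 3 * p - 1) (k2 - 2 * p).+2) +
         G Odd k2.+1 (k2 - 2 * p).+1
           *: C2 T (ket T (n + 3 * p) (k2 - 2 * p).+1)) +
      G Odd k2.+1 0%N *: C1 T (ket T (n + 3 * kappa + 2) 0)
  | EvenC1 =>
      C1 T (ket T n k2.+1) +
      G Even k2.+1 k2 *: C2 T (ket T n.+1 k2) +
      \sum_(1 <= p < kappa.+1)
        (G Even k2.+1 (k2 - 2 * p)%N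
           *: C2 T (ket T (n + 3 * p + 1) (k2 - 2 * p)) +
         G Even k2.+1 (k2 - 2 * p).+1
           *: C1 T (ket T (n + 3 * p) (k2 - 2 * p).+1))
  | EvenC2 =>
      C2 T (ket T n k2) +
      \sum_(1 <= p < kappa.+1)
        (G Even k2 (k2 - 2 * p).+1
           *: C1 T (ket T (n + 3 * p - 1) (k2 - 2 * p).+1) +
         G Even k2 (k2 - 2 * p)%N
           *: C2 T (ket T (n + 3 * p) (k2 - 2 * p)))
  end.

Definition summand (R : realType) (T : 'I_8 -> 'M[R[i]]_3) (fam : sol_family)
    (kappa : nat) (E : R) (n : nat) : state R :=
  (laguerre (lag_index fam kappa) n (2 * E))%:C%C *: mode T fam kappa n.

(* The number of values of n at cut-off N; meaningful when
   6 kappa + offset fam <= N. *)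
Definition range_size (fam : sol_family) (kappa N : nat) : nat :=
  ((N - (6 * kappa + offset fam)) %/ 2).+1.

(* Main.v *)
(* On the bosonic Fock space, identified with the polynomials in eight variables
   x_A, the operator a^dagger_A is multiplication by x_A and a_A is d/dx_A.  With
   X = sum_A x_A T^A, q = tr X^2 and c = tr X^3, the state C_t |j, k> has
   f^dagger_B component e_B q^j c^k with e_B = tr (T^B X) or tr (T^B X^2), and
   (aa) is half the Laplacian.  The completeness relation of the T^A and the
   Cayley-Hamilton theorem for the traceless matrix X give all gradients of
   q, c, e_B, hence the Laplacian of e_B q^j c^k.  The recursion defining the
   mixing constants says exactly that the modes M_n satisfy
   (aa) M_n = n (n + alpha) M_(n-1), (a^dagger a^dagger) M_n = M_(n+1) and
   2 (a^dagger a) M_n = (2 n + alpha - 3) M_n.  The three-term recurrence of the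
   L_n then telescopes H applied to sum_(n < M) L_n M_n into E times this sum plus
   multiples of L_M M_(M-1) and L_(M-1) M_M.  At the cut-off the first vanishes by
   the quantization condition and the second is projected out; for M to infinity
   both leave every fixed particle number.  The sums are nonzero because M_0 does
   not vanish where X is a cyclic permutation matrix (q = 0, c = 3).  Finally, if
   L_n had no zero in an interval, its logarithmic derivative would satisfy a
   Riccati equation that blows up in finite time when n is large. *)

Require Import Defs.
From mathcomp Require Import all_boot all_order all_algebra.
From mathcomp Require Import boolp classical_sets functions reals topology.
From mathcomp Require Import normedtype derive realfun sequences exp trigo.
From mathcomp Require Import complex ring lra zify.
From mathcomp Require Import -(notations) mpoly.

Set Implicit Arguments.
Unset Strict Implicit.
Unset Printing Implicit Defensive.

Import Order.TTheory GRing.Theory Num.Theory.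
Import numFieldNormedType.Exports.
Local Open Scope ring_scope.

(** * Laguerre polynomials *)

Section Laguerre.
Variables (R : realType) (al : nat).

Definition laguerre_poly (n : nat) : {poly R} :=
  \poly_(i < n.+1) ((-1) ^+ i / (i`! * (n - i)`! * (al + i)`!)%:R).

Lemma laguerre_horner n x : laguerre al n x = (laguerre_poly n).[x].
Proof.
rewrite /laguerre horner_poly; apply: eq_bigr => i _.
by rewrite (exprNn x) [RHS]mulrAC.
Qed.

(** The coefficient of ['X^i] splits as [h i * g n i]. With [g] extended by 0 above [n], the rules
    [gSS] and [g_rec] hold for all indices, so the identities below reduce to [ring] coefficient by
    coefficient. *)
Let g (n i : nat) : R := if (i <= n)%N then ((n - i)`!)%:R^-1 else 0.
Let h (i : nat) : R := (-1) ^+ i / (i`! * (al + i)`!)%:R.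

Let gSS n i : g n.+1 i.+1 = g n i.
Proof. by rewrite /g ltnS subSS. Qed.

Let factR_neq0 n : (n`!)%:R != 0 :> R.
Proof. by rewrite pnatr_eq0 -lt0n fact_gt0. Qed.

Let g_rec n i : g n i = (n.+1%:R - i%:R) * g n.+1 i.
Proof.
rewrite /g; case: (ltngtP i n.+1) => [|ni|->]; last 1 first.
- by rewrite ltnn subrr mul0r.
- rewrite ltnS => ni; rewrite ni subSn // factS natrM invfM -natrB; last exact: leqW.
  by rewrite subSn // mulVKf // pnatr_eq0.
by rewrite leqNgt (ltn_trans _ ni) // mulr0.
Qed.

Let h_rec i : h i = - (i.+1%:R * (al + i.+1)%:R * h i.+1).
Proof.
rewrite /h exprS addnS !factS !natrM; field.
by rewrite !factR_neq0 -natrD !nat1r !pnatr_eq0.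
Qed.

Let coef_laguerre_poly n i : (laguerre_poly n)`_i = h i * g n i.
Proof.
rewrite coef_poly ltnS /h /g; case: leqP => // _; last by rewrite mulr0.
by rewrite !natrM !invfM; ring.
Qed.

Lemma laguerre_poly1 :
  (al.+1)%:R *: laguerre_poly 1 = (al.+1)%:R *: laguerre_poly 0 - 'X * laguerre_poly 0.
Proof.
apply/polyP => i; rewrite coefB !coefZ coefXM !coef_laguerre_poly.
case: i => [|i] /=.
  rewrite [g 0 0]g_rec; ring.
rewrite gSS [g 0 i.+1]g_rec gSS [h i]h_rec.
have -> : g 0 i = (i == 0%N)%:R by case: i => [|i]; rewrite /g //= invr1.
by case: i => [|i] /=; rewrite ?addn1 ?addnS; ring.
Qed.

(** Dividing the classical polynomials by Gamma (n + alpha + 1) makes the coefficient of the lowest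
    polynomial in the classical recurrence constant. *)
Lemma laguerre_poly_rec n :
  (n.+2 * (n.+2 + al))%:R *: laguerre_poly n.+2 =
  (2 * n + 3 + al)%:R *: laguerre_poly n.+1 - 'X * laguerre_poly n.+1 - laguerre_poly n.
Proof.
apply/polyP => i; rewrite !coefB !coefZ coefXM !coef_laguerre_poly.
case: i => [|i] /=.
  by rewrite [g n 0]g_rec [g n.+1 0]g_rec; ring.
rewrite [g n i.+1]g_rec !gSS [g n i]g_rec [h i]h_rec addnS; ring.
Qed.

Lemma laguerre_poly_ode n :
  'X * (laguerre_poly n)^`()^`() + (al.+1)%:R *: (laguerre_poly n)^`()
    - 'X * (laguerre_poly n)^`() + n%:R *: laguerre_poly n = 0.
Proof.
apply/polyP => i; rewrite coef0 !(coefD, coefN, coefZ, coefXM, coef_deriv).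
case: i => [|i] /=; rewrite !coef_laguerre_poly.
  rewrite [h 0]h_rec [g n 1]g_rec gSS; ring.
by rewrite [h i.+1]h_rec [g n i.+2]g_rec gSS addnS; ring.
Qed.

End Laguerre.

(** For x <= 0 all terms of the sum are nonnegative and the one with i = 0 is positive. *)
Lemma laguerre_root_gt0 (R : realType) (al n : nat) (x : R) :
  laguerre al n x = 0 -> 0 < x.
Proof.
move=> Lx0; rewrite ltNge; apply/negP => xle0; move/eqP: Lx0; apply/negP.
apply: lt0r_neq0; rewrite /laguerre big_ord_recl /= ltr_pwDl //.
  by rewrite expr0 mul1r invr_gt0 ltr0n !muln_gt0 !fact_gt0.
by apply: sumr_ge0 => i _; apply: mulr_ge0; rewrite ?exprn_ge0 ?invr_ge0 ?oppr_ge0.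
Qed.

Lemma laguerre_at0_neq0 (R : realType) (al : nat) (x : R) : laguerre al 0 x != 0.
Proof.
by rewrite /laguerre big_ord1 expr0 mul1r invr_eq0 pnatr_eq0 -lt0n !muln_gt0 !fact_gt0.
Qed.

(* If p has no zero on [a, b], then u = p' / p satisfies the Riccati equation
   u' = - u^2 - ((al + 1) / x - 1) u - n / x, so that for large n the derivative
   of atan (u / k) is at most - k / 2; over [a, b] its variation would be pi. *)
Lemma laguerre_root_itv (R : realType) (al : nat) (a b : R) :
  0 < a -> a < b -> exists n0, forall n, (n0 <= n)%N ->
  exists2 y, y \in `[a, b] & laguerre al n y = 0.
Proof.
move=> a0 ab; have b0 : 0 < b by apply: lt_trans ab.
(* On [a, b], [B] bounds the coefficient (al + 1) / x - 1; [k] is chosen so that a slope of - k / 2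
   over the length b - a gives exactly - pi. *)
pose B := al.+1%:R / a + 1; pose k := 2 * pi / (b - a).
have ba0 : 0 < b - a by rewrite subr_gt0.
have k0 : 0 < k by rewrite divr_gt0 // mulr_gt0 // pi_gt0.
(* From this index on, n / b is at least (B^2 + k^2) / 2, which absorbs the linear term of the
   Riccati equation after completing the square. *)
exists (Num.bound (b * ((B ^+ 2 + k ^+ 2) / 2))) => n n0n.
have nlarge : (B ^+ 2 + k ^+ 2) / 2 <= n%:R / b.
  rewrite ler_pdivlMr // mulrC ltW //.
  apply: (@lt_le_trans _ _ (Num.bound (b * ((B ^+ 2 + k ^+ 2) / 2)))%:R); last by rewrite ler_nat.
  apply: archi_boundP.
  by rewrite mulr_ge0 ?(ltW b0) // divr_ge0 // addr_ge0 // sqr_ge0.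
apply: contrapT => noroot.
pose p := laguerre_poly R al n.
have pN0 y : y \in `[a, b] -> p.[y] != 0.
  by move=> yab; apply/eqP => py; apply: noroot; exists y => //; rewrite laguerre_horner.
pose u y := p^`().[y] / p.[y].
pose u' y := p^`()^`().[y] / p.[y] - u y ^+ 2.
have du y : y \in `[a, b] -> is_derive y 1 u (u' y).
  move=> yab; have dV := is_deriveV (pN0 y yab) (is_derive_poly p y).
  have dM := is_deriveM (is_derive_poly p^`() y) dV.
  apply: (@is_derive_eq _ _ _ _ _ _ _ _ dM).
  rewrite /u' /u /GRing.scale /=.
  by field; exact: pN0.
pose f y := atan (k^-1 * u y).
pose f' y := (1 + (k^-1 * u y) ^+ 2)^-1 * (k^-1 * u' y).
have df y : y \in `[a, b] -> is_derive y 1 f (f' y).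
  move=> yab; have := is_deriveZ k^-1 (du y yab) => duy.
  exact: is_derive1_comp (is_derive1_atan _) duy.
have contf : {within `[a, b], continuous f}%classic.
  apply: derivable_within_continuous => y yab.
  by case: (df y yab).
have [c cab fE] := MVT ab (fun y yab => df y (subset_itv_oo_cc yab)) contf.
have cab' := subset_itv_oo_cc cab.
move: cab; rewrite in_itv /= => /andP[ac cb].
have c0 : 0 < c := lt_trans a0 ac.
have := congr1 (horner ^~ c) (laguerre_poly_ode R al n).
rewrite !hornerE -/p => ode.
have pcc : p^`()^`().[c] = - ((al.+1%:R / c - 1) * p^`().[c] + n%:R / c * p.[c]).
  apply: (mulfI (lt0r_neq0 c0)).
  transitivity (- (al.+1%:R * p^`().[c] - c * p^`().[c] + n%:R * p.[c])).
    by apply/eqP; rewrite -subr_eq0 -ode; apply/eqP; ring.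
  by field; exact: lt0r_neq0.
have uE : u' c = - u c ^+ 2 - (al.+1%:R / c - 1) * u c - n%:R / c.
  by rewrite /u' pcc /u; field; rewrite pN0 // lt0r_neq0.
have Bc : `|al.+1%:R / c - 1| <= B.
  have le_ca : al.+1%:R / c <= al.+1%:R / a.
    by rewrite ler_wpM2l // lef_pV2 ?posrE // ltW.
  have ge0c : 0 <= al.+1%:R / c by rewrite divr_ge0 // ltW.
  by rewrite /B ler_norml; apply/andP; split; lra.
have u'le : u' c <= - ((u c ^+ 2 + k ^+ 2) / 2).
  have nbc : n%:R / b <= n%:R / c by rewrite ler_wpM2l // lef_pV2 ?posrE // ltW.
  have sqB : (al.+1%:R / c - 1) ^+ 2 <= B ^+ 2.
    by rewrite -real_normK ?num_real // lerXn2r // ?nnegrE // (le_trans _ Bc).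
  have sq := sqr_ge0 (u c + (al.+1%:R / c - 1)).
  rewrite uE; move: nlarge nbc sqB sq.
  by set D := al.+1%:R / c - 1; set e := n%:R / c; set e' := n%:R / b; nra.
(* Here f' = k u' / (k^2 + u^2), so the bound on u' cancels the denominator. *)
have f'le : f' c <= - (k / 2).
  have pos : 0 < 1 + (k^-1 * u c) ^+ 2 by rewrite ltr_pwDl // sqr_ge0.
  rewrite /f' mulrC ler_pdivrMr // ler_pdivrMl //.
  apply: le_trans u'le _; rewrite le_eqVlt; apply/orP; left; apply/eqP.
  by field; exact: lt0r_neq0.
(* The values of [atan] lie strictly between - pi / 2 and pi / 2, so [f] cannot drop by pi. *)
have : - pi < f b - f a.
  have := atan_gtNpi2 (k^-1 * u b); have := atan_ltpi2 (k^-1 * u a).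
  rewrite -/(f a) -/(f b); lra.
rewrite fE ltNge => /negP; apply.
apply: (@le_trans _ _ (- (k / 2) * (b - a))); first by rewrite ler_wpM2r // ltW.
rewrite le_eqVlt; apply/orP; left; apply/eqP.
by rewrite /k; field; exact: lt0r_neq0.
Qed.

Lemma laguerre_root_dense (R : realType) (al : nat) (x eps : R) :
  0 < x -> 0 < eps -> exists n0, forall n, (n0 <= n)%N ->
  exists2 y, `|y - x| < eps & laguerre al n y = 0.
Proof.
move=> x0 e0.
(* The half-width m / 2 keeps the interval around x on the positive axis and within eps of x. *)
have [m [m0 mx me]] : exists m, [/\ 0 < m, m <= x & m <= eps].
  by exists (Num.min x eps); rewrite lt_min x0 e0 !ge_min !lexx orbT.
have a0 : 0 < x - m / 2 by lra.
have ab : x - m / 2 < x + m / 2 by lra.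
have [n0 dense] := laguerre_root_itv al a0 ab.
exists n0 => n /dense [y]; rewrite in_itv /= => /andP[y1 y2] Ly; exists y => //.
by rewrite ltr_norml; apply/andP; split; lra.
Qed.

(** * Linear algebra of the generators *)

(* The 9 x 9 matrix with rows T^A and 1 has a left inverse with columns 2 T^A
   (transposed) and 1 / 3, which is also a right inverse. *)
Lemma su3_completeness (F : numFieldType) (T : 'I_8 -> 'M[F]_3) :
  (forall A, \tr (T A) = 0) ->
  (forall A B, \tr (T A *m T B) = (A == B)%:R / 2) ->
  forall i j k l, \sum_A T A i j * T A k l =
    ((i == l)%:R * (j == k)%:R - (i == j)%:R * (k == l)%:R / 3) / 2.
Proof.
move=> tr0 trT i j k l.
have sum_vec (f : 'I_3 -> 'I_3 -> F) (u v : 'rV_(3 * 3)) :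
    (forall i j, u 0 (mxvec_index i j) * v 0 (mxvec_index i j) = f i j) ->
    \sum_p u 0 p * v 0 p = \sum_i \sum_j f i j.
  move=> uvf; rewrite (reindex (uncurry (@mxvec_index 3 3))) /=; last first.
    exact: curry_mxvec_bij.
  by rewrite pair_bigA; apply: eq_bigr => -[x y] _ /=.
have trE (U V : 'M[F]_3) : \sum_p (mxvec U) 0 p * (mxvec V^T) 0 p = \tr (U *m V).
  rewrite (sum_vec (fun i j => U i j * V j i)); last first.
    by move=> x y; rewrite !mxvecE mxE.
  by rewrite /mxtrace; apply: eq_bigr => x _; rewrite mxE.
pose A1 : 'M[F]_(8, 3 * 3) := \matrix_A mxvec (T A).
pose B1 : 'M[F]_(8, 3 * 3) := \matrix_A mxvec (2 *: T A)^T.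
pose a1 : 'rV[F]_(3 * 3) := mxvec 1%:M.
pose b1 : 'rV[F]_(3 * 3) := mxvec ((3^-1)%:M)^T.
have MN : col_mx A1 a1 *m row_mx B1^T b1^T = 1%:M.
  rewrite mul_col_row scalar_mx_block; congr block_mx.
  - apply/matrixP => x y; rewrite !mxE.
    under eq_bigr do rewrite !mxE.
    rewrite trE -scalemxAr mxtraceZ trT mulrCA mulfV ?mulr1 //.
    by rewrite pnatr_eq0.
  - apply/matrixP => x y; rewrite (ord1 y) !mxE.
    under eq_bigr do rewrite !mxE.
    by rewrite trE mul_mx_scalar mxtraceZ tr0 mulr0.
  - apply/matrixP => x y; rewrite (ord1 x) !mxE.
    under eq_bigr do rewrite !mxE.
    by rewrite trE mul1mx mxtraceZ tr0 mulr0.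
  apply/matrixP => x y; rewrite (ord1 x) (ord1 y) !mxE.
  under eq_bigr do rewrite !mxE.
  by rewrite trE mul1mx mxtrace_scalar -[LHS]mulr_natr mulVf // pnatr_eq0.
have := mulmx1C MN; rewrite mul_row_col => /matrixP.
move=> /(_ (mxvec_index j i) (mxvec_index k l)).
rewrite !mxE big_ord1 !mxE !mxvecE !mxE.
under eq_bigr do rewrite !mxE !mxvecE !mxE.
under eq_bigr do rewrite -mulrA.
have a1E : a1 ord0 (mxvec_index k l) = (k == l)%:R.
  by apply: etrans (mxvecE _ _ _) _; rewrite mxE.
rewrite -mulr_sumr a1E => H.
have eqix : (mxvec_index j i == mxvec_index k l) = (i == l) && (j == k).
  have inj := bij_inj (onT_bij (curry_mxvec_bij 3 3)).
  by rewrite (inj_eq inj (j, i) (k, l)) xpair_eqE andbC.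
have two0 : (2 : F) != 0 by rewrite pnatr_eq0.
apply: (mulfI two0); rewrite -[LHS](addrK (3^-1 *+ (i == j) * (k == l)%:R)) H eqix.
by rewrite -mulnb natrM -[_ *+ (i == j)]mulr_natr; field.
Qed.

(** This is M^3 = (tr M^2 / 2) M + tr M^3 / 3, multiplied by 6 to make sense over any commutative
    ring. Eliminating the last diagonal entry through the trace leaves polynomial identities between
    entries. *)
Lemma cayley_hamilton3_tr0 (P : comPzRingType) (M : 'M[P]_3) :
  \tr M = 0 ->
  (M *m M *m M) *+ 6 = (\tr (M *m M) *: M) *+ 3 + (\tr (M *m M *m M))%:M *+ 2.
Proof.
pose i0 := ord0 : 'I_3; pose i1 := lift i0 (ord0 : 'I_2).
pose i2 := lift i0 (lift (ord0 : 'I_2) (ord0 : 'I_1)).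
have sum3 (f : 'I_3 -> P) : \sum_i f i = f i0 + f i1 + f i2.
  by rewrite !big_ord_recl big_ord0 addr0 addrA.
have ord3 (i : 'I_3) : [\/ i = i0, i = i1 | i = i2].
  case: (unliftP ord0 i) => [j|] ->; last exact: Or31.
  case: (unliftP ord0 j) => [k|] ->; last exact: Or32.
  by rewrite (ord1 k); exact: Or33.
rewrite /mxtrace sum3 => trM.
have M22 : M i2 i2 = - M i0 i0 - M i1 i1.
  by apply/eqP; rewrite -subr_eq0 -trM; apply/eqP; ring.
apply/matrixP => i j; rewrite !(mxE, sum3).
case: (ord3 i) => ->; case: (ord3 j) => -> /=; rewrite !M22; ring.
Qed.

(** Contracting the completeness relation with the entries of M projects M on its traceless part.
    The ring is arbitrary because both polynomial and scalar matrices are expanded later. *)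
Lemma matrix_expand (P : comNzRingType) (Tp : 'I_8 -> 'M[P]_3) :
  (forall i j k l, (\sum_A Tp A i j * Tp A k l) *+ 6 =
    (i == l)%:R * (j == k)%:R *+ 3 - (i == j)%:R * (k == l)%:R) ->
  forall M : 'M[P]_3,
  (\sum_A \tr (Tp A *m M) *: Tp A) *+ 6 = M *+ 3 - (\tr M)%:M.
Proof.
move=> complete M; apply/matrixP => k l.
rewrite mulmxnE; have -> : (\sum_A \tr (Tp A *m M) *: Tp A) k l =
    \sum_i \sum_j M j i * \sum_A Tp A i j * Tp A k l.
  rewrite summxE.
  under eq_bigr => A _.
    rewrite mxE /mxtrace mulr_suml.
    under eq_bigr => i _ do rewrite mxE mulr_suml.
    over.
  rewrite exchange_big; apply: eq_bigr => i _ /=.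
  rewrite exchange_big; apply: eq_bigr => j _ /=.
  by rewrite mulr_sumr; apply: eq_bigr => A _; ring.
rewrite -sumrMnl; under eq_bigr => i _.
  rewrite -sumrMnl.
  under eq_bigr => j _ do rewrite -mulrnAr complete mulrBr.
  rewrite sumrB (bigD1 k) //= [X in _ + X - _]big1 => [|j /negPf ->]; last first.
    by rewrite mulr0 mul0rn mulr0.
  rewrite (bigD1 i) //= [X in _ - (_ + X)]big1 => [|j]; last first.
    by rewrite eq_sym => /negPf ->; rewrite mul0r mulr0.
  rewrite !eqxx mulr1 mul1r !addr0.
  over.
rewrite sumrB (bigD1 l) //= [X in _ + X - _]big1 => [|i /negPf ->]; last first.
  by rewrite mul0rn mulr0.
rewrite eqxx addr0 -mulr_suml -/(\tr M).
rewrite [RHS]mxE mulmxnE [X in _ = _ + X]mxE [_%:M k l]mxE.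
by rewrite mulrnAr mulr1 mulr_natr.
Qed.

(** * The invariant polynomials *)

Section PolynomialSector.
Variables (F : numFieldType) (T : 'I_8 -> 'M[F]_3).
Hypothesis tr0 : forall A, \tr (T A) = 0.
Hypothesis trT : forall A B, \tr (T A *m T B) = (A == B)%:R / 2.

Local Notation P := (mpoly 8 F).

Definition var A : P := mpolyX F (mnm1 A).

Definition Tpoly A : 'M[P]_3 := map_mx (@mpolyC 8 F) (T A).

Definition Xpoly : 'M[P]_3 := \sum_A var A *: Tpoly A.

(* (a^dagger a^dagger) and (a^dagger a^dagger a^dagger) act as multiplication by
   quadp and cubp; upoly B and vpoly B are the coefficients of f^dagger_B in C1
   and C2. *)
Definition quadp : P := \tr (Xpoly *m Xpoly).

Definition cubp : P := \tr (Xpoly *m Xpoly *m Xpoly).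

Definition upoly B : P := \tr (Tpoly B *m Xpoly).

Definition vpoly B : P := \tr (Tpoly B *m (Xpoly *m Xpoly)).

Let mpolyC_natM (n : nat) (a : F) : mpolyC 8 a *+ n = mpolyC 8 (a *+ n).
Proof. by rewrite raddfMn. Qed.

Lemma Tpoly_tr0 A : \tr (Tpoly A) = 0.
Proof. by rewrite /Tpoly trace_map_mx tr0 raddf0. Qed.

Lemma Tpoly_tr A B : \tr (Tpoly A *m Tpoly B) *+ 2 = (A == B)%:R.
Proof.
rewrite /Tpoly -map_mxM trace_map_mx trT mpolyC_natM -[_ / _ *+ _]mulr_natr divfK ?pnatr_eq0 //.
by rewrite rmorph_nat.
Qed.

Lemma Xpoly_tr0 : \tr Xpoly = 0.
Proof.
rewrite /Xpoly raddf_sum big1 // => A _.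
by rewrite /= mxtraceZ Tpoly_tr0 mulr0.
Qed.

Lemma upolyE A : upoly A *+ 2 = var A.
Proof.
rewrite /upoly /Xpoly mulmx_sumr raddf_sum -sumrMnl (bigD1 A) //= big1 => [|B /negPf BA].
  by rewrite addr0 -scalemxAr mxtraceZ -mulrnAr Tpoly_tr eqxx mulr1.
by rewrite -scalemxAr mxtraceZ -mulrnAr Tpoly_tr eq_sym BA mulr0.
Qed.

Let Tpoly_complete i j k l : (\sum_A Tpoly A i j * Tpoly A k l) *+ 6 =
  (i == l)%:R * (j == k)%:R *+ 3 - (i == j)%:R * (k == l)%:R.
Proof.
under eq_bigr do rewrite !mxE -rmorphM /=.
rewrite -rmorph_sum su3_completeness // -rmorphMn /=.
rewrite -!(rmorph_nat (@mpolyC 8 F)) -!rmorphM -rmorphMn -rmorphB.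
by congr mpolyC; rewrite /=; field.
Qed.

Lemma Tpoly_expand (M : 'M[P]_3) :
  (\sum_A \tr (Tpoly A *m M) *: Tpoly A) *+ 6 = M *+ 3 - (\tr M)%:M.
Proof. exact: matrix_expand. Qed.

(** The quadratic Casimir of the defining representation is 4 / 3; it comes from the completeness
    relation by summing over the inner index. *)
Lemma Tpoly_casimir : (\sum_A Tpoly A *m Tpoly A) *+ 6 = 8%:M.
Proof.
apply/matrixP => i l; rewrite mulmxnE summxE.
have -> : \sum_A (Tpoly A *m Tpoly A) i l = \sum_j \sum_A Tpoly A i j * Tpoly A j l.
  by rewrite exchange_big; apply: eq_bigr => A _; rewrite mxE.
rewrite -sumrMnl; under eq_bigr do rewrite Tpoly_complete eqxx mulr1.
rewrite sumrB sumr_const card_ord (bigD1 i) //= big1 => [|j].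
  by rewrite eqxx mul1r addr0 mxE -mulrnA; ring.
by rewrite eq_sym => /negPf ->; rewrite mul0r.
Qed.

Lemma Tpoly_contract (M N : 'M[P]_3) :
  (\sum_A \tr (Tpoly A *m M) * \tr (Tpoly A *m N)) *+ 6 =
  \tr (M *m N) *+ 3 - \tr M * \tr N.
Proof.
transitivity (\tr ((\sum_A \tr (Tpoly A *m M) *: Tpoly A) *+ 6 *m N)).
  rewrite -[in RHS]scaler_nat -scalemxAl mxtraceZ mulr_natl mulmx_suml raddf_sum /=; congr (_ *+ _).
  by apply: eq_bigr => A _; rewrite -scalemxAl mxtraceZ.
by rewrite Tpoly_expand mulmxBl raddfB -scaler_nat -scalemxAl /= mul_scalar_mx !mxtraceZ mulr_natl.
Qed.

End PolynomialSector.

(** * Product rules for gradients and the Laplacian *)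

Section Laplacian.
Variables (F : numFieldType) (n : nat).

Local Notation P := (mpoly n F).
Implicit Types f g h : P.

Definition gdot f g : P := \sum_A mderiv A f * mderiv A g.

Definition laplacian f : P := \sum_A mderiv A (mderiv A f).

Lemma mderiv_exp A f k : mderiv A (f ^+ k) = (f ^+ k.-1 * mderiv A f) *+ k.
Proof.
elim: k => [|k IH]; first by rewrite expr0 (mderivC A 1) mulr0n.
rewrite exprS mderivM IH /=; case: k {IH} => [|k] /=; first by rewrite expr0; ring.
by rewrite exprS; ring.
Qed.

Lemma gdotC f g : gdot f g = gdot g f.
Proof. by apply: eq_bigr => A _; rewrite mulrC. Qed.

Lemma gdotM f g h : gdot f (g * h) = g * gdot f h + h * gdot f g.
Proof.
rewrite /gdot !mulr_sumr -big_split; apply: eq_bigr => A _ /=.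
by rewrite mderivM; ring.
Qed.

Lemma gdot_exp f g k : gdot f (g ^+ k) = (g ^+ k.-1 * gdot f g) *+ k.
Proof.
rewrite /gdot mulr_sumr -sumrMnl; apply: eq_bigr => A _.
by rewrite mderiv_exp; ring.
Qed.

Lemma laplacianD : {morph laplacian : f g / f + g}.
Proof.
move=> f g; rewrite /laplacian -big_split; apply: eq_bigr => A _ /=.
by rewrite !mderivD.
Qed.

Lemma laplacian0 : laplacian 0 = 0.
Proof. by rewrite /laplacian big1 // => A _; rewrite !mderiv0. Qed.

Lemma laplacianZ (a : F) f : laplacian (a *: f) = a *: laplacian f.
Proof.
rewrite /laplacian scaler_sumr; apply: eq_bigr => A _ /=.
by rewrite !mderivZ.
Qed.

Lemma laplacianM f g :
  laplacian (f * g) = f * laplacian g + g * laplacian f + gdot f g *+ 2.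
Proof.
rewrite /laplacian /gdot !mulr_sumr -sumrMnl -!big_split.
by apply: eq_bigr => A _ /=; rewrite mderivM mderivD !mderivM; ring.
Qed.

Lemma laplacian_exp f k : laplacian (f ^+ k) =
  (f ^+ k.-1 * laplacian f) *+ k + (f ^+ k.-2 * gdot f f) *+ (k * k.-1).
Proof.
rewrite /laplacian /gdot !mulr_sumr -!sumrMnl -big_split.
apply: eq_bigr => A _ /=.
by rewrite mderiv_exp mderivMn mderivM mderiv_exp; ring.
Qed.

(** The factor q restores the powers of q lost by differentiation, so the cases j = 0 and j = 1 need
    no separate formula; the factor 4 clears the denominator of |grad c|^2. The polynomial [w]
    carries the mixing between C1 and C2 states. *)
Lemma laplacian_monomial (d : nat) (q c e w : P) (j k : nat) :
  gdot q q = q *+ 2 -> gdot q c = c *+ 3 -> gdot c c *+ 4 = q ^+ 2 *+ 3 ->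
  laplacian q = 8 -> laplacian c = 0 -> laplacian e = 0 ->
  gdot q e = e *+ d -> gdot c e *+ 2 = w ->
  q * laplacian (e * (q ^+ j * c ^+ k)) *+ 4 =
    (e * (q ^+ j * c ^+ k)) *+ (8 * (j * (j + 3 * k + 3 + d)))
    + (e * (q ^+ j.+3 * c ^+ k.-2)) *+ (3 * (k * k.-1))
    + (w * (q ^+ j.+1 * c ^+ k.-1)) *+ (4 * k).
Proof.
move=> qq qc cc lq lc le qe ce.
rewrite !laplacianM !laplacian_exp le lq lc gdotM !gdot_exp -ce.
rewrite [gdot (_ ^+ j) _]gdotC gdot_exp [gdot e q]gdotC [gdot e c]gdotC [gdot c q]gdotC.
rewrite qq qc qe.
transitivity ((e * (q ^+ j * c ^+ k.-2)) * q *+ (k * k.-1) * (gdot c c *+ 4)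
  + (e * c ^+ k * (q * q ^+ j.-1 *+ j * 8 + q * (q ^+ j.-2 * q *+ (j * j.-1)) * 2
       + q * q ^+ j.-1 *+ j *+ d * 2)
     + c * c ^+ k.-1 *+ k * e * (q * q ^+ j.-1 *+ j) * 6
     + q * q ^+ j * c ^+ k.-1 *+ k * (gdot c e *+ 2)) *+ 4); first by ring.
have jE : q * q ^+ j.-1 *+ j = q ^+ j *+ j.
  by case: (j) => [|i]; rewrite ?mulr0n // exprS.
have jjE : q * (q ^+ j.-2 * q *+ (j * j.-1)) = q ^+ j *+ (j * j.-1).
  by case: (j) => [|[|i]]; rewrite ?muln0 ?mul0n ?mulr0n ?mulr0 //= !exprS; ring.
have kE : c * c ^+ k.-1 *+ k = c ^+ k *+ k.
  by case: (k) => [|i]; rewrite ?mulr0n // exprS.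
rewrite cc jE jjE kE !exprS.
have jjN (x : P) : x *+ (j * j.-1) = x * (j%:R * j%:R - j%:R).
  by case: (j) => [|i] /=; ring.
by rewrite jjN; ring.
Qed.

End Laplacian.

(** * Gradients of the invariants *)

Lemma mxtrace_cycle (R : comPzRingType) n (M N L : 'M[R]_n) :
  \tr (M *m (N *m L)) = \tr (N *m (L *m M)).
Proof. by rewrite mxtrace_mulC -mulmxA. Qed.

Section AbstractGradients.
Variables (P : comNzRingType) (D : 'I_8 -> P -> P) (x : 'I_8 -> P).
Variables (Tp : 'I_8 -> 'M[P]_3) (X : 'M[P]_3).
Hypothesis D0 : forall A, D A 0 = 0.
Hypothesis DD : forall A, {morph D A : f g / f + g}.
Hypothesis DM : forall A f g, D A (f * g) = D A f * g + f * D A g.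
Hypothesis Dx : forall A B, D A (x B) = (A == B)%:R.
Hypothesis DT : forall A B, map_mx (D A) (Tp B) = 0.
Hypothesis natrI : forall n, (0 < n)%N -> injective (fun f : P => f *+ n).
Hypothesis XE : X = \sum_A x A *: Tp A.
Hypothesis tr0 : forall A, \tr (Tp A) = 0.
Hypothesis trT : forall A B, \tr (Tp A *m Tp B) *+ 2 = (A == B)%:R.
Hypothesis trX0 : \tr X = 0.
Hypothesis uE : forall A, \tr (Tp A *m X) *+ 2 = x A.
Hypothesis expand : forall M : 'M[P]_3,
  (\sum_A \tr (Tp A *m M) *: Tp A) *+ 6 = M *+ 3 - (\tr M)%:M.
Hypothesis casimir : (\sum_A Tp A *m Tp A) *+ 6 = 8%:M.
Hypothesis contract : forall M N : 'M[P]_3,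
  (\sum_A \tr (Tp A *m M) * \tr (Tp A *m N)) *+ 6 =
  \tr (M *m N) *+ 3 - \tr M * \tr N.

Let q := \tr (X *m X).
Let c := \tr (X *m X *m X).
Let u A := \tr (Tp A *m X).
Let v A := \tr (Tp A *m (X *m X)).
Let grad f g := \sum_A D A f * D A g.
Let lap f := \sum_A D A (D A f).

Let Dsum A := big_morph (D A) (DD A) (D0 A).

Let DMn A f n : D A (f *+ n) = D A f *+ n.
Proof. by elim: n => [|n IH]; rewrite ?mulr0n ?D0 // !mulrS DD IH. Qed.

Let DMx A m n p (M : 'M[P]_(m, n)) (N : 'M[P]_(n, p)) :
  map_mx (D A) (M *m N) = map_mx (D A) M *m N + M *m map_mx (D A) N.
Proof.
apply/matrixP => i j; rewrite !mxE Dsum -big_split.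
by apply: eq_bigr => k _; rewrite /= DM !mxE.
Qed.

Let Dtr A (M : 'M[P]_3) : D A (\tr M) = \tr (map_mx (D A) M).
Proof. by rewrite /mxtrace Dsum; apply: eq_bigr => i _; rewrite mxE. Qed.

Let DX A : map_mx (D A) X = Tp A.
Proof.
have DTe B i j : D A (Tp B i j) = 0 by have /matrixP/(_ i j) := DT A B; rewrite !mxE.
apply/matrixP => i j; rewrite XE mxE summxE Dsum (bigD1 A) //= big1 => [|B BA].
  by rewrite addr0 !mxE DM DTe Dx eqxx mulr0 addr0 mul1r.
by rewrite !mxE DM DTe Dx eq_sym (negPf BA) mulr0 mul0r addr0.
Qed.

Let trXM M : \tr (X *m M) = \sum_A x A * \tr (Tp A *m M).
Proof.
rewrite {1}XE mulmx_suml raddf_sum; apply: eq_bigr => A _.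
by rewrite /= -scalemxAl mxtraceZ.
Qed.

Let Dq A : D A q = x A.
Proof.
by rewrite /q Dtr DMx !DX raddfD /= [\tr (X *m _)]mxtrace_mulC -uE.
Qed.

Let Dc A : D A c = v A *+ 3.
Proof.
rewrite /c Dtr !DMx !DX mulmxDl !raddfD /= -!mulmxA.
rewrite (mxtrace_cycle X X (Tp A)) (mxtrace_cycle X (Tp A) X).
by rewrite /v; ring.
Qed.

Let Du A B : D A (u B) *+ 2 = (A == B)%:R.
Proof. by rewrite /u Dtr DMx DT DX mul0mx add0r trT eq_sym. Qed.

Let Dv A B :
  D A (v B) = \tr (Tp A *m (X *m Tp B + Tp B *m X)).
Proof.
rewrite /v Dtr !DMx DT mul0mx add0r !DX !mulmxDr !raddfD /=.
by rewrite (mxtrace_cycle (Tp B) (Tp A)) (mxtrace_cycle (Tp B) X) (mxtrace_cycle X (Tp A)).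
Qed.

Let grad_q f : grad q f = \sum_A x A * D A f.
Proof. by apply: eq_bigr => A _; rewrite Dq. Qed.

Let grad_qq : grad q q = q *+ 2.
Proof.
rewrite grad_q; under eq_bigr do rewrite Dq -{2}uE.
by rewrite /q trXM -sumrMnl; apply: eq_bigr => A _; rewrite mulrnAr.
Qed.

Let grad_qc : grad q c = c *+ 3.
Proof.
rewrite grad_q; under eq_bigr do rewrite Dc.
by rewrite /c -mulmxA trXM -sumrMnl; apply: eq_bigr => A _; rewrite mulrnAr.
Qed.

Let sum_vT : (\sum_A v A *: Tp A) *+ 6 = (X *m X) *+ 3 - q%:M.
Proof. by rewrite expand. Qed.

Let grad_qu B : grad q (u B) = u B.
Proof.
rewrite grad_q (bigD1 B) //= big1 => [|A AB]; last first.
  by apply: (@natrI 2) => //; rewrite -mulrnAr Du (negPf AB) mulr0 mul0rn.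
apply: (@natrI 2) => //=; rewrite addr0 -mulrnAr Du eqxx mulr1.
by rewrite uE.
Qed.

Let grad_qv B : grad q (v B) = v B *+ 2.
Proof.
rewrite grad_q; under eq_bigr do rewrite Dv -mxtraceZ scalemxAl.
rewrite -raddf_sum -mulmx_suml -XE /= mulmxDr raddfD /= /v.
by rewrite (mxtrace_cycle X X) (mxtrace_cycle X (Tp B)) mulr2n.
Qed.

Let grad_cu B : grad c (u B) *+ 2 = v B *+ 3.
Proof.
rewrite -sumrMnl (bigD1 B) //= big1 => [|A AB]; last first.
  by rewrite -mulrnAr Du (negPf AB) mulr0.
by rewrite -mulrnAr Du eqxx mulr1 addr0 Dc.
Qed.

Let X3E := cayley_hamilton3_tr0 trX0.

Let mulmxMn (M N : 'M[P]_3) n : (M *+ n) *m N = (M *m N) *+ n.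
Proof. by elim: n => [|n IH]; rewrite ?mulr0n ?mul0mx // !mulrS mulmxDl IH. Qed.

Let trX3 M : \tr (X *m X *m X *m M) *+ 6 = q * \tr (X *m M) *+ 3 + c * \tr M *+ 2.
Proof.
rewrite -raddfMn /= -mulmxMn X3E mulmxDl !mulmxMn -scalemxAl mul_scalar_mx.
by rewrite raddfD !raddfMn /= !mxtraceZ.
Qed.

(** The gradient of c contracted with the generators is a combination of X^2 and q. The resulting tr
    (X^3 T^B) is reduced by Cayley-Hamilton, where the term in tr X^3 drops out because T^B is
    traceless. *)
Let grad_cv B : grad c (v B) *+ 2 = q * u B.
Proof.
apply: (@natrI 3) => //=.
transitivity (\tr (((\sum_A v A *: Tp A) *+ 6) *m (X *m Tp B + Tp B *m X)) *+ 3).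
  rewrite mulmxMn raddfMn /= mulmx_suml raddf_sum.
  rewrite /grad -!sumrMnl; apply: eq_bigr => A _.
  by rewrite Dc Dv /= -scalemxAl mxtraceZ; ring.
rewrite sum_vT mulmxBl mulmxMn !mulmxDr !mul_scalar_mx raddfB raddfMn /= !raddfD /= !mxtraceZ.
rewrite !mulmxA [\tr (X *m X *m Tp B *m X)]mxtrace_mulC !mulmxA.
have := trX3 (Tp B); rewrite tr0 mulr0 mul0rn addr0 (mxtrace_mulC X) -/(u B).
set t := \tr (X *m X *m X *m Tp B) => tE.
transitivity (t *+ 6 *+ 3 - q * u B *+ 6); first ring.
by rewrite tE; ring.
Qed.

Let grad_cc : grad c c *+ 4 = q ^+ 2 *+ 3.
Proof.
rewrite /grad; under eq_bigr do rewrite !Dc.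
transitivity ((\sum_A v A * v A) *+ 6 *+ 6).
  by rewrite -!sumrMnl; apply: eq_bigr => A _; ring.
rewrite contract !mulmxA mulrnBl -mulrnA mulnC mulrnA.
by rewrite trX3 trX0 mulr0 mul0rn addr0 -/q; ring.
Qed.

Let lap_q : lap q = 8.
Proof.
rewrite /lap; under eq_bigr do rewrite Dq Dx eqxx.
by rewrite sumr_const card_ord.
Qed.

Let lap_u B : lap (u B) = 0.
Proof.
rewrite /lap big1 // => A _; apply: (@natrI 2) => //=.
rewrite -DMn Du mul0rn; case: (A == B); last exact: D0.
(* A derivation kills 1, since the product rule gives D 1 = D 1 + D 1. *)
by have := DM A 1 1; rewrite !mulr1 mul1r => /eqP; rewrite addrC -subr_eq subrr eq_sym => /eqP.
Qed.

(** By cyclicity both orderings produce the Casimir matrix. The Laplacians of [v B] and [c] thus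
    become multiples of tr T^B and tr X, both zero. *)
Let lapv_aux (M : 'M[P]_3) :
  (\sum_A \tr (Tp A *m (Tp A *m M + M *m Tp A))) *+ 3 = \tr M *+ 8.
Proof.
transitivity (\tr (((\sum_A Tp A *m Tp A) *+ 6) *m M)).
  rewrite -[in RHS]scaler_nat -scalemxAl mxtraceZ mulr_natl mulmx_suml raddf_sum.
  rewrite -!sumrMnl; apply: eq_bigr => A _.
  by rewrite mulmxDr raddfD /= mulmxA 2!(mxtrace_cycle _ _ (Tp A)) -mulmxA; ring.
by rewrite casimir mul_scalar_mx mxtraceZ mulr_natl.
Qed.

Let lap_v B : lap (v B) = 0.
Proof.
apply: (@natrI 3) => //=; rewrite mul0rn /lap.
transitivity (\tr (Tp B) *+ 8); last by rewrite tr0 mul0rn.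
rewrite -lapv_aux.
congr (_ *+ _); apply: eq_bigr => A _.
by rewrite Dv !mulmxDr !raddfD /= DD !Dtr !DMx !DT !DX !(mul0mx, mulmx0, add0r, addr0).
Qed.

Let lap_c : lap c = 0.
Proof.
transitivity (\tr X *+ 8); last by rewrite trX0 mul0rn.
rewrite -lapv_aux -sumrMnl.
by apply: eq_bigr => A _; rewrite Dc DMn Dv addrC.
Qed.

(** Only derivation rules, trace identities and cancellation of integer factors enter. The gradient
    of c exchanges [u] and [v], which is the origin of the mixing; the multiple [*+ 1] displays the
    degree in the form that [laplacian_monomial] expects. *)
Lemma su3_gradients :
  [/\ forall A, D A q = x A, grad q q = q *+ 2, grad q c = c *+ 3,
      grad c c *+ 4 = q ^+ 2 *+ 3 & lap q = 8] /\ lap c = 0 /\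
  (forall B, [/\ lap (u B) = 0, grad q (u B) = u B *+ 1 & grad c (u B) *+ 2 = v B *+ 3]) /\
  (forall B, [/\ lap (v B) = 0, grad q (v B) = v B *+ 2 & grad c (v B) *+ 2 = q * u B]).
Proof. by do !split; rewrite ?grad_qu. Qed.

End AbstractGradients.

(** * Laplacian and Euler operator on the one-fermion monomials *)

Section SectorLaplacian.
Variables (F : numFieldType) (T : 'I_8 -> 'M[F]_3).
Hypothesis tr0 : forall A, \tr (T A) = 0.
Hypothesis trT : forall A B, \tr (T A *m T B) = (A == B)%:R / 2.

Local Notation P := (mpoly 8 F).
Local Notation q := (quadp T).
Local Notation c := (cubp T).
Local Notation u := (upoly T).
Local Notation v := (vpoly T).

Lemma mpoly_mulrnI n : (0 < n)%N -> injective (fun f : P => f *+ n).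
Proof.
move=> n0 f g /eqP; rewrite -subr_eq0 -mulrnBl -mulr_natr mulf_eq0 => /orP[|].
  by rewrite subr_eq0 => /eqP.
by rewrite -mpolyC_nat mpolyC_eq0 pnatr_eq0 eqn0Ngt n0.
Qed.

Lemma mderiv_var A B : mderiv A (var F B) = (A == B)%:R.
Proof.
rewrite /var mderivX mnm1E eq_sym; case: eqVneq => [->|_]; last by rewrite scale0r.
rewrite scale1r (_ : mnm_sub _ _ = @mnm0 8) ?mpolyX0 //.
by apply/mnmP => C; rewrite mnmBE mnm0E subnn.
Qed.

Definition invpoly (j k : nat) : P := q ^+ j * c ^+ k.

Lemma invpoly00 : invpoly 0 0 = 1.
Proof. by rewrite /invpoly !expr0 mulr1. Qed.

Lemma invpolyS j k : q * invpoly j k = invpoly j.+1 k.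
Proof. by rewrite /invpoly exprS mulrA. Qed.

Lemma invpoly0S k : c * invpoly 0 k = invpoly 0 k.+1.
Proof. by rewrite /invpoly !expr0 !mul1r exprS. Qed.

Let gradients :
  [/\ forall A, mderiv A q = var F A, gdot q q = q *+ 2, gdot q c = c *+ 3,
      gdot c c *+ 4 = q ^+ 2 *+ 3 & laplacian q = 8] /\ laplacian c = 0 /\
  (forall B, [/\ laplacian (u B) = 0, gdot q (u B) = u B *+ 1 &
                 gdot c (u B) *+ 2 = v B *+ 3]) /\
  (forall B, [/\ laplacian (v B) = 0, gdot q (v B) = v B *+ 2 &
                 gdot c (v B) *+ 2 = q * u B]).
Proof.
apply: (@su3_gradients P (@mderiv 8 F) (var F) (Tpoly T) (Xpoly T)).
- exact: mderiv0.
- exact: mderivD.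
- exact: mderivM.
- exact: mderiv_var.
- by move=> A B; apply/matrixP => i j; rewrite !mxE mderivC.
- exact: mpoly_mulrnI.
- by [].
- exact: Tpoly_tr0.
- exact: Tpoly_tr.
- exact: Xpoly_tr0.
- exact: upolyE.
- exact: Tpoly_expand.
- exact: Tpoly_casimir.
- exact: Tpoly_contract.
Qed.

(** Its Laplacian is 8. This permits cancelling q from the Laplacian formulas. *)
Lemma quadp_neq0 : q != 0.
Proof.
have [[_ _ _ _ lq] _] := gradients.
apply/eqP => q0; have /eqP := lq; rewrite q0 laplacian0 eq_sym.
by rewrite -mpolyC_nat mpolyC_eq0 pnatr_eq0.
Qed.

Lemma laplacian_upoly B j k :
  q * laplacian (u B * (q ^+ j * c ^+ k)) *+ 4 =
    (u B * (q ^+ j * c ^+ k)) *+ (8 * (j * (j + 3 * k + 3 + 1)))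
    + (u B * (q ^+ j.+3 * c ^+ k.-2)) *+ (3 * (k * k.-1))
    + (v B *+ 3 * (q ^+ j.+1 * c ^+ k.-1)) *+ (4 * k).
Proof.
have [[_ qq qc cc lq] [lc [/(_ B)[lu qu cu] _]]] := gradients.
exact: laplacian_monomial.
Qed.

Lemma laplacian_vpoly B j k :
  q * laplacian (v B * (q ^+ j * c ^+ k)) *+ 4 =
    (v B * (q ^+ j * c ^+ k)) *+ (8 * (j * (j + 3 * k + 3 + 2)))
    + (v B * (q ^+ j.+3 * c ^+ k.-2)) *+ (3 * (k * k.-1))
    + (q * u B * (q ^+ j.+1 * c ^+ k.-1)) *+ (4 * k).
Proof.
have [[_ qq qc cc lq] [lc [_ /(_ B)[lv qv cv]]]] := gradients.
exact: laplacian_monomial.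
Qed.

Definition euler (f : P) : P := \sum_A var F A * mderiv A f.

Lemma eulerD : {morph euler : f g / f + g}.
Proof.
move=> f g; rewrite /euler -big_split; apply: eq_bigr => A _ /=.
by rewrite mderivD mulrDr.
Qed.

Lemma euler0 : euler 0 = 0.
Proof. by rewrite /euler big1 // => A _; rewrite mderiv0 mulr0. Qed.

Lemma eulerZ (a : F) f : euler (a *: f) = a *: euler f.
Proof.
rewrite /euler scaler_sumr; apply: eq_bigr => A _ /=.
by rewrite mderivZ scalerAr.
Qed.

Lemma euler_monomial e d j k : euler e = e *+ d ->
  euler (e * (q ^+ j * c ^+ k)) = (e * (q ^+ j * c ^+ k)) *+ (d + 2 * j + 3 * k).
Proof.
have [[Dq qq qc _ _] _] := gradients.
(* The gradient of q is the position vector, so the Euler operator is the gradient product with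
   q. *)
have eulerE f : euler f = gdot q f by apply: eq_bigr => A _; rewrite Dq.
rewrite !eulerE !gdotM !gdot_exp qq qc => ->.
have expE (a : P) m : a ^+ m.-1 * a *+ m = a ^+ m *+ m.
  by case: m => [|m]; rewrite ?mulr0n // exprSr.
transitivity (e * (q ^+ j * (c ^+ k.-1 * c *+ k) *+ 3 + c ^+ k * (q ^+ j.-1 * q *+ j) *+ 2)
   + q ^+ j * c ^+ k * (e *+ d)); first by ring.
by rewrite !expE; ring.
Qed.

Lemma euler_upoly B : euler (u B) = u B *+ 1.
Proof.
have [[Dq _ _ _ _] [_ [/(_ B)[_ <- _] _]]] := gradients.
by apply: eq_bigr => A _; rewrite Dq.
Qed.

Lemma euler_vpoly B : euler (v B) = v B *+ 2.
Proof.
have [[Dq _ _ _ _] [_ [_ /(_ B)[_ <- _]]]] := gradients.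
by apply: eq_bigr => A _; rewrite Dq.
Qed.

End SectorLaplacian.

(** * The mixing constants *)

Section Mixing.
Variables (R : realType) (c : parity) (m : nat).

(* (alpha_m - alpha_(m - s)) / 2 *)
Definition mix_shift (s : nat) : nat := (3 * s + ~~ c1_index c m)./2.

Lemma mix_shift0 : mix_shift 0 = 0%N.
Proof. by rewrite /mix_shift; case: c1_index. Qed.

Lemma mix_shift2 s : mix_shift s.+2 = (mix_shift s + 3)%N.
Proof.
rewrite /mix_shift (_ : 3 * s.+2 + _ = (3 * s + ~~ c1_index c m) + 3.*2)%N; last by lia.
by rewrite halfD doubleK odd_double andbF add0n.
Qed.

Lemma c1_indexS t : c1_index c t.+1 = ~~ c1_index c t.
Proof. by case: c. Qed.

Lemma c1_indexB s : (s <= m)%N -> c1_index c (m - s) = c1_index c m (+) odd s.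
Proof.
move=> sm; rewrite -{2}(subnK sm); move: (m - s)%N => t {sm}.
elim: s => [|s IH]; first by rewrite addbF addn0.
by rewrite addnS c1_indexS /= addbN addNb negbK.
Qed.

(** Conservation of degree: one factor c of degree 3 is lost while e_B changes between degrees 1 and
    2, which leaves 1 or 2 powers of q to be supplied. *)
Lemma mix_shiftS s : (s <= m)%N ->
  mix_shift s.+1 = (mix_shift s + (if c1_index c (m - s) then 1 else 2))%N.
Proof.
move=> sm; rewrite c1_indexB // /mix_shift.
have := odd_double_half s; set h := s./2; case: (odd s) => /= <-; case: (c1_index c m) => /=; lia.
Qed.

Lemma mix_alphaE s : (s <= m)%N ->
  (mix_alpha c (m - s) + 2 * mix_shift s = mix_alpha c m)%N.
Proof.
move=> sm; rewrite /mix_alpha c1_indexB // /mix_shift.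
have := odd_double_half s; set h := s./2.
case: (odd s) => /= sE; case: (c1_index c m) => /=; lia.
Qed.

Lemma mix_shift_gt0 s : (0 < s)%N -> (0 < mix_shift s)%N.
Proof. by rewrite /mix_shift; lia. Qed.

(** As alpha_m = alpha_y + 2 sh, the denominator alpha_m^2 - alpha_y^2 equals 4 sh (sh + alpha_y);
    it is positive, and the recursion can be written without division. *)
Lemma mix_rec_eq s : (s < m)%N ->
  (mix_shift s.+1 * (mix_shift s.+1 + mix_alpha c (m - s.+1)))%:R * mix_rec R c m s.+1 =
  mix_chi R c (m - s.+1) * mix_rec R c m s +
  (if s is s'.+1 then mix_mu R (m - s.+1) * mix_rec R c m s' else 0).
Proof.
move=> sm; set y := (m - s.+1)%N.
have sh0 : (mix_shift s.+1)%:R != 0 :> R by rewrite pnatr_eq0 -lt0n mix_shift_gt0.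
have sa0 : (mix_shift s.+1)%:R + (mix_alpha c y)%:R != 0 :> R.
  by rewrite -natrD pnatr_eq0 addn_eq0 negb_and -!lt0n mix_shift_gt0.
have denE : mix_den R c m y =
    4 * (mix_shift s.+1)%:R * ((mix_shift s.+1)%:R + (mix_alpha c y)%:R).
  by rewrite /mix_den -(mix_alphaE sm) -/y; ring.
case: s @y sm sh0 sa0 denE => [|s] y sm sh0 sa0 denE.
  rewrite [mix_rec R c m 1]/= -/y denE [mix_rec R c m 0]/=.
  by field; rewrite sa0.
have -> : mix_rec R c m s.+2 = 4 * (mix_chi R c y * mix_rec R c m s.+1
    + mix_mu R y * mix_rec R c m s) / mix_den R c m y by [].
by rewrite denE; field; rewrite sa0.
Qed.

End Mixing.

(** * The mixed modes and their ladder relations *)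

Section Modes.
Variables (R : realType) (F : numFieldType) (phi : {rmorphism R -> F}).
Variable T : 'I_8 -> 'M[F]_3.
Hypothesis tr0 : forall A, \tr (T A) = 0.
Hypothesis trT : forall A B, \tr (T A *m T B) = (A == B)%:R / 2.
Variables (c : parity) (m : nat).

Local Notation P := (mpoly 8 F).
Local Notation al := (mix_alpha c m).
Local Notation ga := (mix_rec R c m).
Local Notation sh := (mix_shift c m).

Definition fpoly t B : P := if c1_index c t then upoly T B else vpoly T B.

(* The f^dagger_B component of C_1 or C_2 applied to |n + shift, m - s>. *)
Definition chain n s B : P :=
  fpoly (m - s) B * invpoly T (n + sh s) (m - s).

(** One chain, indexed by the distance s to the top index, covers all four families. *)
Definition modepoly n B : P := \sum_(s < m.+1) phi (ga s) *: chain n s B.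

Lemma chainS n s B : chain n.+1 s B = quadp T * chain n s B.
Proof. by rewrite /chain addSn -invpolyS mulrCA. Qed.

Lemma modepolyS n B : modepoly n.+1 B = quadp T * modepoly n B.
Proof.
rewrite /modepoly mulr_sumr; apply: eq_bigr => s _.
by rewrite chainS scalerAr.
Qed.

(** The Laplacian only couples s to s, s + 1 and s + 2. Where these leave the chain, the factors m -
    s and (m - s)(m - s - 1) vanish. *)
Lemma laplacian_chain n s B : (s <= m)%N ->
  quadp T * laplacian (chain n s B) *+ 4 =
  chain n s B *+ (8 * ((n + sh s) * (n + sh s + mix_alpha c (m - s)))) +
  chain n s.+2 B *+ (3 * ((m - s) * (m - s).-1)) +
  chain n s.+1 B *+ (4 * ((m - s) * (if c1_index c (m - s) then 3%N else 1%N))).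
Proof.
move=> sm; rewrite /chain /invpoly mix_shift2 mix_shiftS // !subnS.
set t := (m - s)%N; rewrite /mix_alpha /fpoly; case ct: (c1_index c t).
  rewrite laplacian_upoly //; congr (_ + _ + _).
  - by congr (_ *+ (_ * (_ * _))); lia.
  - case: t ct => [|[|t]] //; rewrite !c1_indexS negbK => -> /=.
    by rewrite addnA addn3.
  case: t ct => [|t] //; rewrite c1_indexS => /negPf -> /=.
  by rewrite addnA addn1 mulrnAl -mulrnA; congr (_ *+ _); lia.
rewrite laplacian_vpoly //; congr (_ + _ + _).
- by congr (_ *+ (_ * (_ * _))); lia.
- case: t ct => [|[|t]] //; rewrite !c1_indexS negbK => -> /=.
  by rewrite addnA addn3.
case: t ct => [|t] //; rewrite c1_indexS => /negbFE -> /=.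
rewrite muln1 addnA addn2 [in RHS]exprS [quadp T * upoly T B]mulrC.
by rewrite -!mulrA.
Qed.

(** The shifts give all members of the chain the same degree 2 n + al - 3. *)
Lemma euler_chain n s B : (s <= m)%N ->
  euler (chain n s B) + chain n s B *+ 3 = chain n s B *+ (2 * n + al).
Proof.
move=> sm; rewrite -(mix_alphaE c sm) /chain /invpoly /fpoly /mix_alpha.
case: (c1_index c (m - s)).
  rewrite (euler_monomial tr0 trT _ _ (euler_upoly tr0 trT B)) -mulrnDr.
  by congr (_ *+ _); lia.
rewrite (euler_monomial tr0 trT _ _ (euler_vpoly tr0 trT B)) -mulrnDr.
by congr (_ *+ _); lia.
Qed.

#[local] Arguments mix_rec : simpl never.

Let shift1 (x : nat -> F) (b : nat -> P) : x m = 0 ->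
  \sum_(s < m.+1) x s *: b s.+1 =
  \sum_(s < m.+1) (if s : nat is s'.+1 then x s' else 0) *: b s.
Proof.
move=> xm; rewrite big_ord_recr big_ord_recl /= xm !scale0r addr0 add0r.
by apply: eq_bigr.
Qed.

(** In the coefficient of [chain n s], the diagonal value exceeds n (n + al) by sh (sh + alpha_(m -
    s)). By [mix_rec_eq] the contributions of s - 1 and s - 2 cancel exactly this excess. *)
Lemma laplacian_modepoly_mul n B :
  quadp T * laplacian (modepoly n B) *+ 4 = modepoly n B *+ (8 * (n * (n + al))).
Proof.
pose t s := (m - s)%N.
pose x s : F := phi (ga s * (4 * (t s * (if c1_index c (t s) then 3%N else 1%N)))%:R).
pose y s : F := phi (ga s * (3 * (t s * (t s).-1))%:R).
pose z s : F := phi (ga s * (8 * ((n + sh s) * (n + sh s + mix_alpha c (t s))))%:R).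
have natZ (r : R) k (p : P) : phi r *: (p *+ k) = phi (r * k%:R) *: p.
  by rewrite rmorphM rmorph_nat -scalerA scaler_nat.
have laplacian_sum : laplacian (modepoly n B) =
    \sum_(s < m.+1) phi (ga s) *: laplacian (chain n s B).
  rewrite /modepoly (big_morph _ (@laplacianD F 8) (@laplacian0 F 8)).
  by apply: eq_bigr => s _; rewrite laplacianZ.
rewrite laplacian_sum mulr_sumr -sumrMnl.
transitivity (\sum_(s < m.+1) z s *: chain n s B + \sum_(s < m.+1) y s *: chain n s.+2 B
   + \sum_(s < m.+1) x s *: chain n s.+1 B).
  rewrite -!big_split; apply: eq_bigr => s _ /=.
  rewrite -scalerAr scalerMnr laplacian_chain; last by rewrite -ltnS.
  by rewrite !scalerDr !natZ.
have t0 : t m = 0%N by rewrite /t subnn.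
rewrite (@shift1 x (fun s => chain n s B)); last first.
  by rewrite /x t0 mul0n muln0 mulr0 rmorph0.
rewrite (@shift1 y (fun s => chain n s.+1 B)); last first.
  by rewrite /y t0 mul0n muln0 mulr0 rmorph0.
(* The shift by two is done as two shifts by one; [y1 m] vanishes because [t] is 1 at m - 1 and has
   predecessor 0. *)
pose y1 s := if s is s'.+1 then y s' else 0.
rewrite (@shift1 y1 (fun s => chain n s B)); last first.
  rewrite /y1 /y /t; case: (m) => [|m'] //.
  by rewrite subSn // subnn [0.+1.-1]/= !muln0 mulr0 rmorph0.
rewrite -!big_split -[RHS]scaler_nat scaler_sumr; apply: eq_bigr => s _ /=.
rewrite -!scalerDl scalerA; congr (_ *: _).
have sm : (s <= m)%N by rewrite -ltnS.
rewrite -(rmorph_nat phi) -rmorphM /=.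
case: s sm => -[|s] /= _ sm.
  by rewrite !addr0; congr (phi _); rewrite /t subn0 mix_shift0 !addn0 mulrC.
have y1E : y1 s = phi (if s is s'.+1 then ga s' * (3 * (t s' * (t s').-1))%:R else 0).
  by rewrite /y1; case: (s) => [|s'] //; rewrite rmorph0.
rewrite y1E -!rmorphD; congr (phi _).
have := mix_rec_eq R c sm; rewrite -(mix_alphaE c sm).
have ts : t s = (m - s.+1).+1 by rewrite /t; lia.
rewrite ts -/(t s.+1) c1_indexS; set k := t s.+1.
have -> : mix_chi R c k = - (1 / 2) * (k.+1 * (if ~~ c1_index c k then 3%N else 1%N))%:R.
  by rewrite /mix_chi; case: (c1_index c k) => /=; rewrite natrM; field.
have yE : (if s is s'.+1 then ga s' * (3 * (t s' * (t s').-1))%:R else 0) =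
    - 8 * (if s is s'.+1 then mix_mu R k * ga s' else 0).
  case: (s) sm @k ts => [|s'] sm k ts; first by rewrite mulr0.
  have -> : t s' = k.+2 by rewrite /k /t; lia.
  by rewrite /mix_mu [k.+2.-1]/=; rewrite !natrM; field.
rewrite yE; move: (if s is s'.+1 then _ else _) => M.
move: (ga s.+1) (ga s) (if ~~ _ then _ else _) => G1 G0 K E.
transitivity (8 * ((sh s.+1 * (sh s.+1 + mix_alpha c k))%:R * G1) - 8 * M
  + 4 * (k.+1 * K)%:R * G0 + (8 * (n * (n + (mix_alpha c k + 2 * sh s.+1))))%:R * G1).
  ring.
by rewrite E; field.
Qed.

(** Both sides of the previous formula contain q once M_(n+1) = q M_n is used. As (aa) is half the
    Laplacian, this is the lowering relation. *)
Lemma laplacian_modepolyS n B :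
  laplacian (modepoly n.+1 B) *+ 4 = modepoly n B *+ (8 * (n.+1 * (n.+1 + al))).
Proof.
apply: (mulfI (quadp_neq0 tr0 trT)).
by rewrite mulrnAr laplacian_modepoly_mul modepolyS mulrnAr.
Qed.

Lemma laplacian_modepoly0 B : laplacian (modepoly 0 B) = 0.
Proof.
apply: (mulfI (quadp_neq0 tr0 trT)); apply: (@mpoly_mulrnI F 4) => //=.
by rewrite laplacian_modepoly_mul mulr0 mul0rn.
Qed.

Lemma euler_modepoly n B :
  euler (modepoly n B) + modepoly n B *+ 3 = modepoly n B *+ (2 * n + al).
Proof.
have -> : euler (modepoly n B) = \sum_(s < m.+1) phi (ga s) *: euler (chain n s B).
  rewrite /modepoly (big_morph _ (@eulerD F) (@euler0 F)).
  by apply: eq_bigr => s _; rewrite eulerZ.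
rewrite /modepoly -!sumrMnl -big_split; apply: eq_bigr => s _ /=.
by rewrite !scalerMnr -scalerDr euler_chain // -ltnS.
Qed.

End Modes.

(** * The Laguerre recurrence as a telescoping sum *)

Section LaguerreLadder.
Variables (R : realType) (F : numFieldType) (phi : {rmorphism R -> F}).
Variables (V : lmodType F) (h : V -> V) (mode : nat -> V) (al : nat) (E : R).
Hypothesis hD : {morph h : f g / f + g}.
Hypothesis hZ : forall a f, h (a *: f) = a *: h f.
Hypothesis h_mode0 :
  h (mode 0) = (al.+1%:R / 2) *: mode 0 - 2^-1 *: mode 1.
Hypothesis h_modeS : forall n, h (mode n.+1) =
  ((2 * n + 3 + al)%:R / 2) *: mode n.+1 - 2^-1 *: mode n.+2
  - ((n.+1 * (n.+1 + al))%:R / 2) *: mode n.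

Local Notation L n := (phi (laguerre al n (2 * E))).

Lemma laguerre_rec0 : al.+1%:R * laguerre al 1 (2 * E) =
  al.+1%:R * laguerre al 0 (2 * E) - (2 * E) * laguerre al 0 (2 * E).
Proof.
have := congr1 (horner ^~ (2 * E)) (laguerre_poly1 R al).
by rewrite !laguerre_horner !hornerE.
Qed.

Lemma laguerre_rec n : (n.+2 * (n.+2 + al))%:R * laguerre al n.+2 (2 * E) =
  (2 * n + 3 + al)%:R * laguerre al n.+1 (2 * E)
  - (2 * E) * laguerre al n.+1 (2 * E) - laguerre al n (2 * E).
Proof.
have := congr1 (horner ^~ (2 * E)) (laguerre_poly_rec R al n).
by rewrite !laguerre_horner !hornerE.
Qed.

(* The recurrence of the Laguerre polynomials telescopes the sum up to the two
   boundary terms. *)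
Lemma laguerre_partial_sum M :
  h (\sum_(n < M.+1) L n *: mode n) =
  phi E *: (\sum_(n < M.+1) L n *: mode n)
  + ((M.+1 * (M.+1 + al))%:R / 2 * L M.+1) *: mode M - (L M / 2) *: mode M.+1.
Proof.
have two0 : (2 : F) != 0 by rewrite pnatr_eq0.
elim: M => [|M IH].
  rewrite !big_ord1 hZ h_mode0 scalerBr !scalerA -scalerDl; congr (_ *: _ - _ *: _).
  have := congr1 phi laguerre_rec0; rewrite rmorphB !rmorphM !rmorph_nat => rec.
  by rewrite mul1n add1n mulrAC rec; field.
rewrite big_ord_recr /= hD IH hZ h_modeS !scalerBr !scalerDr !scalerA.
have rec := congr1 phi (laguerre_rec M); move: rec.
rewrite !rmorphB !rmorphM !rmorph_nat => rec.
set L0 := L M in rec *; set L1 := L M.+1 in rec *; set L2 := L M.+2 in rec *.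
rewrite [((M.+2 * _)%:R / 2 * L2)]mulrAC rec.
(* The boundary term [r] on mode M cancels against the lowered part of h (mode M.+1); [y] is the new
   eigenvalue term, added and subtracted. *)
have swap (p r s t y z : V) : p + r - s + (t - z - r) = p + y + (t - s - y) - z.
  rewrite (addrC (t - z)) addrA (addrAC (p + r)) addrK.
  by rewrite (addrC (t - s)) (addrA (p + y)) addrK !addrA (addrAC p).
rewrite (mulrC L1 ((M.+1 * _)%:R / 2)).
rewrite (swap _ _ _ _ ((phi E * L1) *: mode M.+1)) -!scalerBl.
by congr (_ + _ *: _ - _ *: _); rewrite /GRing.scale /=; field.
Qed.

End LaguerreLadder.

(** * Fock space as a space of polynomials *)

Lemma mcoeff_var (F : numFieldType) (A : 'I_8) (m : multinom 8) (p : mpoly 8 F) :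
  mcoeff m (var F A * p) = if (m A > 0)%N then mcoeff (mnm_sub m (mnm1 A)) p else 0.
Proof.
rewrite /var mulrC; case: posnP => [mA|mA].
  apply: memN_msupp_eq0; rewrite (perm_mem (msuppMX _ _)).
  by apply/mapP => -[k _ mE]; move: mA; rewrite mE mnmDE mnm1E eqxx.
rewrite -{1}(_ : mnm_add (mnm1 A) (mnm_sub m (mnm1 A)) = m) ?mcoeffMX //.
apply/mnmP => B; rewrite mnmDE mnmBE mnm1E; case: eqVneq => [<-|_].
  by rewrite subnKC.
by rewrite subn0.
Qed.

Section Fock.
Variable R : realType.

Local Notation P := (mpoly 8 R[i]).

Definition occ_mnm (n : {ffun 'I_8 -> nat}) : multinom 8 := Multinom [tuple n B | B < 8].

Definition occ_norm (n : {ffun 'I_8 -> nat}) : R[i] := sqrtC (\prod_B (n B)`!)%:R.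

(* X^n corresponds to (a^dagger)^n |0>, whose amplitude on the normalised
   basis vector is sqrt (n!). *)
Definition fock (G : {set 'I_8}) (p : P) : state R := fun s =>
  (s.2 == G)%:R * (occ_norm s.1 * mcoeff (occ_mnm s.1) p).

Lemma fockD G : {morph fock G : p q / p + q}.
Proof.
move=> p q; apply/funext => s; rewrite /fock fctE /= mcoeffD.
by rewrite -!mulrDr.
Qed.

Lemma fockZ G a p : fock G (a *: p) = a *: fock G p.
Proof.
apply/funext => s; rewrite /fock fctE /= mcoeffZ.
by rewrite /GRing.scale /=; ring.
Qed.

Lemma fock0 G : fock G 0 = 0.
Proof. by apply/funext => s; rewrite /fock mcoeff0 !mulr0. Qed.

Lemma occ_mnmE n A : occ_mnm n A = n A.
Proof. exact: mnmE. Qed.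

Lemma occ_mnm_incr A n : occ_mnm (incr A n) = mnm_add (occ_mnm n) (mnm1 A).
Proof. by apply/mnmP => B; rewrite mnmDE !occ_mnmE mnm1E ffunE eq_sym. Qed.

Lemma occ_mnm_decr A n : occ_mnm (decr A n) = mnm_sub (occ_mnm n) (mnm1 A).
Proof. by apply/mnmP => B; rewrite mnmBE !occ_mnmE mnm1E ffunE eq_sym. Qed.

Lemma occ_norm_incr A n :
  occ_norm (incr A n) = sqrtC (n A).+1%:R * occ_norm n.
Proof.
rewrite /occ_norm -sqrtCM ?qualifE /= ?ler0n // -natrM; congr (sqrtC _%:R).
rewrite (bigD1 A) //= [in RHS](bigD1 A) //= ffunE eqxx addn1 factS -mulnA.
congr (_ * (_ * _))%N; apply: eq_bigr => B /negPf BA.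
by rewrite ffunE BA addn0.
Qed.

Lemma boson_fock A G p : boson A (fock G p) = fock G (mderiv A p).
Proof.
apply/funext => -[n H]; rewrite /boson /fock /= mulrCA; congr (_ * _).
rewrite mcoeff_deriv occ_mnm_incr occ_norm_incr occ_mnmE.
rewrite mulrA mulrA -expr2 sqrtCK -[in RHS]mulr_natl; ring.
Qed.

Lemma bosonD_fock A G p : bosonD A (fock G p) = fock G (var _ A * p).
Proof.
apply/funext => -[n H]; rewrite /bosonD /fock /= mulrCA; congr (_ * _).
rewrite mcoeff_var occ_mnmE; case: posnP => [->|nA].
  by rewrite sqrtC0 mul0r mulr0.
have nE : n = incr A (decr A n).
  by apply/ffunP => B; rewrite !ffunE; case: eqP => [->|]; rewrite ?addn0 ?subn0 ?subnK.
rewrite -occ_mnm_decr mulrA; congr (_ * _).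
by rewrite [in RHS]nE occ_norm_incr ffunE eqxx subn1 prednK.
Qed.

Lemma fermionD_fock A p : fermionD A (fock finset.set0 p) = fock [set A] p.
Proof.
apply/funext => -[n H]; rewrite /fermionD /fock /=.
case: ifPn => AH; last first.
  by case: eqP AH => [->|]; rewrite ?inE ?eqxx // mul0r.
rewrite mulrA; congr (_ * _).
case: eqP => [H0|H0]; last first.
  case: eqP => [HA|]; last by rewrite mulr0.
  by case: H0; rewrite HA; apply/setP => B; rewrite !inE andNb.
have -> : H = [set A].
  by rewrite -(finset.setD1K AH) H0 finset.setU0.
rewrite eqxx mulr1 /fsign (_ : [set B in _ | _] = finset.set0) ?cards0 //.
apply/setP => B; rewrite !inE; case: eqP => [->|] //=; exact: ltnn.
Qed.

Lemma vac_fock : vac R = fock finset.set0 1.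
Proof.
apply/funext => -[n H]; rewrite /vac /fock /= xpair_eqE mulrC.
case: (H == _); rewrite ?andbF ?mulr0n ?mulr0 ?mul0r // andbT mulr1.
rewrite mcoeff1; case: eqP => [->|n0].
  rewrite (_ : _ == _) ?mulr1; last first.
    by apply/eqP/mnmP => B; rewrite occ_mnmE ffunE mnm0E.
  by rewrite /occ_norm big1 ?sqrtC1 // => B _; rewrite ffunE.
rewrite (_ : (_ == _) = false) ?mulr0 //; apply/eqP => /mnmP m0; apply: n0.
by apply/ffunP => B; have := m0 B; rewrite occ_mnmE ffunE mnm0E.
Qed.

End Fock.

Section FockOperators.
Variables (R : realType) (T : 'I_8 -> 'M[R[i]]_3).
Hypothesis tr0 : forall A, \tr (T A) = 0.
Hypothesis trT : forall A B, \tr (T A *m T B) = (A == B)%:R / 2.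

Local Notation P := (mpoly 8 R[i]).

Lemma fock_sum G (I : finType) (f : I -> P) :
  fock G (\sum_k f k) = \sum_k fock G (f k).
Proof. exact: (big_morph _ (@fockD R G) (@fock0 R G)). Qed.

Lemma opmx_bosonD_fock k l G p :
  opmx T (@bosonD R) k l (fock G p) = fock G (Xpoly T k l * p).
Proof.
rewrite /Xpoly summxE mulr_suml fock_sum; apply: eq_bigr => A _.
by rewrite bosonD_fock -fockZ !mxE -mulrA mulrCA mul_mpolyC.
Qed.

Lemma opmx_boson_fock k l G p :
  opmx T (@boson R) k l (fock G p) = fock G (\sum_A T A k l *: mderiv A p).
Proof.
by rewrite fock_sum; apply: eq_bigr => A _; rewrite boson_fock -fockZ.
Qed.

Lemma tr2_aDaD_fock G p :
  tr2 (opmx T (@bosonD R)) (opmx T (@bosonD R)) (fock G p) = fock G (quadp T * p).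
Proof.
rewrite /tr2 /quadp /mxtrace mulr_suml fock_sum; apply: eq_bigr => k _.
rewrite mxE mulr_suml fock_sum; apply: eq_bigr => l _.
by rewrite !opmx_bosonD_fock mulrA.
Qed.

Lemma tr3_aDaDaD_fock G p :
  tr3 (opmx T (@bosonD R)) (opmx T (@bosonD R)) (opmx T (@bosonD R)) (fock G p) =
  fock G (cubp T * p).
Proof.
rewrite /tr3 /cubp -mulmxA /mxtrace mulr_suml fock_sum; apply: eq_bigr => k _.
rewrite mxE mulr_suml fock_sum; apply: eq_bigr => l _.
rewrite mxE mulr_sumr mulr_suml fock_sum; apply: eq_bigr => r _.
by rewrite !opmx_bosonD_fock !mulrA.
Qed.

Lemma tr2_aDa_fock G p :
  tr2 (opmx T (@bosonD R)) (opmx T (@boson R)) (fock G p) =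
  fock G (2^-1 *: euler p).
Proof.
transitivity (fock G (\sum_A upoly T A * mderiv A p)); last first.
  congr fock; rewrite /euler scaler_sumr; apply: eq_bigr => A _.
  rewrite -(upolyE trT) mulrnAl -(scaler_nat 2 (_ * _)) scalerA mulVf ?scale1r //.
  by rewrite pnatr_eq0.
rewrite fock_sum; under eq_bigr => A _.
  rewrite /upoly mxtrace_mulC /mxtrace mulr_suml fock_sum.
  under eq_bigr => k _ do rewrite mxE mulr_suml fock_sum.
  over.
rewrite [RHS]exchange_big; apply: eq_bigr => k _.
rewrite [RHS]exchange_big; apply: eq_bigr => l _ /=.
rewrite opmx_boson_fock opmx_bosonD_fock mulr_sumr fock_sum; apply: eq_bigr => A _.
by rewrite mxE -mulrA mul_mpolyC.
Qed.

Lemma tr2_aa_fock G p :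
  tr2 (opmx T (@boson R)) (opmx T (@boson R)) (fock G p) =
  fock G (2^-1 *: laplacian p).
Proof.
transitivity (fock G (\sum_A \sum_B \tr (T A *m T B) *: mderiv A (mderiv B p))).
  transitivity (fock G (\sum_k \sum_l \sum_A \sum_B
      (T A k l * T B l k) *: mderiv A (mderiv B p))).
    rewrite fock_sum; apply: eq_bigr => k _; rewrite fock_sum; apply: eq_bigr => l _.
    rewrite !opmx_boson_fock; congr fock; apply: eq_bigr => A _.
    rewrite [mderiv A _]raddf_sum scaler_sumr; apply: eq_bigr => B _ /=.
    by rewrite mderivZ scalerA.
  congr fock; under [RHS]eq_bigr => A _.
    under eq_bigr => B _.
      rewrite /mxtrace scaler_suml.
      under eq_bigr => k _ do rewrite mxE scaler_suml.
      over.
    rewrite exchange_big; under eq_bigr => k _ do rewrite exchange_big.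
    over.
  rewrite [RHS]exchange_big; apply: eq_bigr => k _.
  by rewrite [RHS]exchange_big.
congr fock; rewrite /laplacian scaler_sumr; apply: eq_bigr => A _.
rewrite (bigD1 A) //= big1 => [|B /negPf BA].
  by rewrite addr0 trT eqxx mul1r.
by rewrite trT eq_sym BA mul0r scale0r.
Qed.

Lemma ket_fock j k : ket T j k = fock finset.set0 (invpoly T j k).
Proof.
rewrite /ket vac_fock -(invpoly00 T).
have -> : iter k (tr3 (opmx T (@bosonD R)) (opmx T (@bosonD R)) (opmx T (@bosonD R)))
    (fock finset.set0 (invpoly T 0 0)) = fock finset.set0 (invpoly T 0 k).
  by elim: k => [|k IH] //; rewrite iterS IH tr3_aDaDaD_fock invpoly0S.
by elim: j => [|j IH] //; rewrite iterS IH tr2_aDaD_fock invpolyS.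
Qed.

Definition fock1 (f : 'I_8 -> P) : state R := \sum_A fock [set A] (f A).

Lemma C1_fock p : C1 T (fock finset.set0 p) = fock1 (fun A => upoly T A * p).
Proof.
rewrite /C1 /fock1 /tr2; under [RHS]eq_bigr => A _.
  rewrite /upoly /mxtrace mulr_suml fock_sum.
  under eq_bigr => k _ do rewrite mxE mulr_suml fock_sum.
  over.
rewrite [RHS]exchange_big; apply: eq_bigr => k _.
rewrite [RHS]exchange_big; apply: eq_bigr => l _ /=.
rewrite opmx_bosonD_fock; apply: eq_bigr => A _.
by rewrite fermionD_fock -fockZ mxE -mulrA mul_mpolyC.
Qed.

Lemma C2_fock p : C2 T (fock finset.set0 p) = fock1 (fun A => vpoly T A * p).
Proof.
rewrite /C2 /fock1 /tr3; under [RHS]eq_bigr => A _.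
  rewrite /vpoly /mxtrace mulr_suml fock_sum.
  under eq_bigr => k _ do rewrite mxE mulr_suml fock_sum.
  over.
rewrite [RHS]exchange_big; apply: eq_bigr => k _.
rewrite [RHS]exchange_big; apply: eq_bigr => l _ /=.
transitivity (\sum_r \sum_A fock [set A] (T A k l *: (Xpoly T l r * (Xpoly T r k * p)))).
  apply: eq_bigr => r _; rewrite !opmx_bosonD_fock; apply: eq_bigr => A _.
  by rewrite fermionD_fock -fockZ.
rewrite exchange_big; apply: eq_bigr => A _.
rewrite -fock_sum; congr fock.
rewrite -scaler_sumr 2!mxE -mul_mpolyC -mulrA; congr (_ * _).
by rewrite mulr_suml; apply: eq_bigr => r _; rewrite mulrA.
Qed.

End FockOperators.

(** * Dependence of an amplitude on nearby amplitudes *)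

Section Locality.
Variable R : realType.

Definition agree (s : occ) (k : nat) (psi phi : state R) : Prop :=
  forall s', s'.2 = s.2 -> (quanta s' <= quanta s + k)%N -> psi s' = phi s'.

(** Continuum states are not images of polynomials. Locality allows replacing them by finite partial
    sums when one amplitude of the image is computed. *)
Definition local_op (k : nat) (x : operator R) : Prop :=
  forall psi phi s, agree s k psi phi -> x psi s = x phi s.

Lemma local_op_comp k l (x y : operator R) :
  local_op k x -> local_op l y -> local_op (k + l) (fun psi => x (y psi)).
Proof.
move=> xk yl psi phi s ag; apply: xk => s' s'2 s'k; apply: yl => s'' s''2 s''k.
by apply: ag; [rewrite s''2|apply: leq_trans s''k _; rewrite addnA leq_add2r].
Qed.

Lemma local_op_sum k (I : finType) (x : I -> operator R) :
  (forall i, local_op k (x i)) -> local_op k (fun psi => \sum_i x i psi).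
Proof.
move=> xk psi phi s ag; rewrite !fct_sumE; apply: eq_bigr => i _; exact: xk.
Qed.

Lemma local_opZ k a (x : operator R) :
  local_op k x -> local_op k (fun psi => a *: x psi).
Proof. by move=> xk psi phi s ag; rewrite !fctE (xk psi phi). Qed.

Lemma quanta_incr A n H : quanta (incr A n, H) = (quanta (n, H)).+1.
Proof.
rewrite /quanta /= (bigD1 A) //= [in RHS](bigD1 A) //= ffunE eqxx addn1 addSn.
by congr ((_ + _).+1); apply: eq_bigr => B /negPf BA; rewrite ffunE BA addn0.
Qed.

Lemma local_boson A : local_op 1 (@boson R A).
Proof.
move=> psi phi [n H] ag; rewrite /boson /= ag //=.
by rewrite quanta_incr addn1.
Qed.

Lemma local_bosonD A : local_op 0 (@bosonD R A).
Proof.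
move=> psi phi [n H] ag; rewrite /bosonD /= ag //= addn0.
by apply: leq_sum => B _; rewrite ffunE leq_subr.
Qed.

Lemma local_opmx (T : 'I_8 -> 'M[R[i]]_3) k (x : 'I_8 -> operator R) :
  (forall A, local_op k (x A)) -> forall i j, local_op k (opmx T x i j).
Proof. by move=> xk i j; apply: local_op_sum => A; exact: local_opZ. Qed.

Lemma local_tr2 k l (X Y : 'I_3 -> 'I_3 -> operator R) :
  (forall i j, local_op k (X i j)) -> (forall i j, local_op l (Y i j)) ->
  local_op (k + l) (tr2 X Y).
Proof.
move=> Xk Yl; apply: local_op_sum => i; apply: local_op_sum => j.
exact: local_op_comp.
Qed.

Lemma local_op_le k l x : (k <= l)%N -> local_op k x -> local_op l x.
Proof.
move=> kl xk psi phi s ag; apply: xk => s' s'2 s'k; apply: ag => //.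
by apply: leq_trans s'k _; rewrite leq_add2l.
Qed.

Lemma local_hamiltonian (T : 'I_8 -> 'M[R[i]]_3) : local_op 2 (hamiltonian T).
Proof.
have lb := local_opmx T local_boson; have lbD := local_opmx T local_bosonD.
have l2 : local_op 2 (tr2 (opmx T (@boson R)) (opmx T (@boson R))) by exact: (@local_tr2 1 1).
have l1 : local_op 2 (tr2 (opmx T (@bosonD R)) (opmx T (@boson R))).
  by apply: (@local_op_le 1) => //; exact: (@local_tr2 0 1).
have l0 : local_op 2 (tr2 (opmx T (@bosonD R)) (opmx T (@bosonD R))).
  by apply: (@local_op_le 0) => //; exact: (@local_tr2 0 0).
move=> psi phi s ag; rewrite /hamiltonian !fctE.
by rewrite (l2 psi phi) // (l1 psi phi) // (l0 psi phi) // ag // leq_addr.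
Qed.

(** The signs of f_A and f_A^dagger agree and square to 1, so the operator multiplies an amplitude
    by the number of filled modes. *)
Lemma fermion_number_singleton (psi : state R) :
  (forall s : occ, #|s.2| != 1%N -> psi s = 0) -> fermion_number psi = psi.
Proof.
move=> psi0; apply/funext => -[n H]; rewrite /fermion_number fct_sumE.
transitivity (\sum_(A in H) psi (n, H)).
  rewrite [RHS]big_mkcond; apply: eq_bigr => A _; rewrite /fermionD /fermion /=.
  case: ifPn => // AH; rewrite finset.in_setD1 eqxx /= finset.setD1K //.
  rewrite mulrA /fsign -exprD; set k := #|_|; set l := #|_|.
  have -> : l = k.
    apply: eq_card => B; rewrite !inE; case: (eqVneq B A) => [->|] //=.
    by rewrite ltnn !andbF.
  by rewrite addnn -mul2n exprM sqrrN expr1n expr1n mul1r.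
rewrite sumr_const; case: (eqVneq #|H| 1%N) => [-> //|H1].
by rewrite psi0 // mul0rn.
Qed.

End Locality.

Lemma mcoeff_euler (F : numFieldType) (f : mpoly 8 F) (k : multinom 8) :
  mcoeff k (euler f) = mcoeff k f *+ mdeg k.
Proof.
rewrite /euler raddf_sum mdegE -sumrMnr; apply: eq_bigr => A _ /=.
rewrite mcoeff_var mcoeff_deriv; case: posnP => [->|kA]; first by rewrite mulr0n.
have -> : mnm_add (mnm_sub k (mnm1 A)) (mnm1 A) = k.
  apply/mnmP => B; rewrite mnmDE mnmBE mnm1E; case: eqVneq => [<-|_].
    by rewrite subnK.
  by rewrite subn0 addn0.
by rewrite mnmBE mnm1E eqxx subn1 prednK.
Qed.

(** * The Hamiltonian on polynomials and the partial sums of modes *)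

Section Waves.
Variables (R : realType) (F : numFieldType) (phi : {rmorphism R -> F}).
Variable T : 'I_8 -> 'M[F]_3.
Hypothesis tr0 : forall A, \tr (T A) = 0.
Hypothesis trT : forall A B, \tr (T A *m T B) = (A == B)%:R / 2.
Variables (c : parity) (m : nat).

Local Notation P := (mpoly 8 F).
Local Notation al := (mix_alpha c m).
Local Notation mode := (modepoly phi T c m).

(** (a^dagger a) is half the Euler operator and (aa) half the Laplacian, whence the factor 1 / 4. *)
Definition hampoly (f : P) : P :=
  2^-1 *: euler f + 2 *: f - 2^-1 *: (quadp T * f) - 4^-1 *: laplacian f.

Definition wavepoly (E : R) (M : nat) (B : 'I_8) : P :=
  \sum_(n < M) phi (laguerre al n (2 * E)) *: mode n B.

Lemma mcoeff_mode n B k : (mdeg k + 3 != 2 * n + al)%N -> mcoeff k (mode n B) = 0.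
Proof.
move=> kn; have := congr1 (mcoeff k) (euler_modepoly phi tr0 trT c m n B).
rewrite mcoeffD !mcoeffMn mcoeff_euler -mulrnDr => /eqP.
rewrite -subr_eq0 -!(mulr_natr (mcoeff _ _)) -mulrBr mulf_eq0 subr_eq0 eqr_nat (negPf kn) orbF.
by move/eqP.
Qed.

Lemma hampolyD : {morph hampoly : f g / f + g}.
Proof.
move=> f g; rewrite /hampoly eulerD laplacianD mulrDr !scalerDr.
by rewrite (addrACA (_ *: euler f)) opprD (addrACA (_ + _)) opprD (addrACA (_ + _ + _)).
Qed.

Lemma hampolyZ a f : hampoly (a *: f) = a *: hampoly f.
Proof.
rewrite /hampoly eulerZ laplacianZ -scalerAr !scalerBr scalerDr !scalerA.
by rewrite !(mulrC a).
Qed.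

Let hampoly_mode_half n B :
  2^-1 *: euler (mode n B) + 2 *: mode n B = ((2 * n + al).+1%:R / 2) *: mode n B.
Proof.
have -> : euler (mode n B) = mode n B *+ (2 * n + al) - mode n B *+ 3.
  by apply/eqP; rewrite -subr_eq opprK euler_modepoly.
rewrite -(scaler_nat (2 * n + al)) -(scaler_nat 3) -scalerBl scalerA -scalerDl; congr (_ *: _).
by field.
Qed.

Lemma hampoly0 : hampoly 0 = 0.
Proof. by rewrite -[X in hampoly X](scale0r 0) hampolyZ scale0r. Qed.

Lemma mcoeff_hampoly f k : mcoeff k (hampoly f) =
  mcoeff k (2^-1 *: euler f) + 2 * mcoeff k f - 2^-1 * mcoeff k (quadp T * f)
  - 2^-1 * mcoeff k (2^-1 *: laplacian f).
Proof.
by rewrite /hampoly !mcoeffB mcoeffD !mcoeffZ; field.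
Qed.

Lemma hampoly_mode0 B :
  hampoly (mode 0 B) = (al.+1%:R / 2) *: mode 0 B - 2^-1 *: mode 1 B.
Proof.
have := hampoly_mode_half 0 B.
rewrite /hampoly => ->; rewrite laplacian_modepoly0 // scaler0 subr0 -modepolyS.
by rewrite muln0 add0n.
Qed.

Lemma hampoly_modeS B n : hampoly (mode n.+1 B) =
  ((2 * n + 3 + al)%:R / 2) *: mode n.+1 B - 2^-1 *: mode n.+2 B
  - ((n.+1 * (n.+1 + al))%:R / 2) *: mode n B.
Proof.
have lapE : laplacian (mode n.+1 B) = (2 * (n.+1 * (n.+1 + al))%:R) *: mode n B.
  apply: (@mpoly_mulrnI F 4) => //=.
  rewrite laplacian_modepolyS // scalerMnl -(scaler_nat (8 * _)); congr (_ *: _); ring.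
rewrite /hampoly hampoly_mode_half lapE -modepolyS scalerA; congr (_ *: _ - _ - _ *: _).
  by congr (_ / _); ring.
by field.
Qed.

Lemma hampoly_wavepoly E M B :
  hampoly (wavepoly E M.+1 B) = phi E *: wavepoly E M.+1 B
  + ((M.+1 * (M.+1 + al))%:R / 2 * phi (laguerre al M.+1 (2 * E))) *: mode M B
  - (phi (laguerre al M (2 * E)) / 2) *: mode M.+1 B.
Proof.
exact: (@laguerre_partial_sum R F phi _ hampoly (fun n => mode n B) al E
  hampolyD hampolyZ (hampoly_mode0 B) (hampoly_modeS B)).
Qed.

#[local] Arguments mix_rec : simpl never.
#[local] Arguments mix_shift : simpl never.

(** At a point where X is the cyclic permutation matrix Y, q vanishes and kills every term but the
    top one. What remains is 3^m tr (T^B M), and the nonzero traceless matrix M cannot be orthogonal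
    to all T^B. *)
Lemma mode0_neq0 : exists B, mode 0 B != 0.
Proof.
pose Y : 'M[F]_3 := \matrix_(i, j) (j == (i.+1 %% 3)%N :> nat)%:R.
pose i0 := ord0 : 'I_3; pose i1 := lift i0 (ord0 : 'I_2).
pose i2 := lift i0 (lift (ord0 : 'I_2) (ord0 : 'I_1)).
have sum3 (f : 'I_3 -> F) : \sum_i f i = f i0 + f i1 + f i2.
  by rewrite !big_ord_recl big_ord0 addr0 addrA.
have trY : \tr Y = 0 by rewrite /mxtrace sum3 !mxE /= !addr0.
have trYY : \tr (Y *m Y) = 0.
  rewrite /mxtrace sum3 !(mxE, sum3) /=; ring.
have trYYY : \tr (Y *m Y *m Y) = 3.
  rewrite /mxtrace sum3 !(mxE, sum3) /=; ring.
have expandF (M : 'M[F]_3) :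
    (\sum_A \tr (T A *m M) *: T A) *+ 6 = M *+ 3 - (\tr M)%:M.
  by apply: matrix_expand => i j k l; rewrite su3_completeness //; field.
(* These are the coordinates of Y in the basis T, by the normalisation tr (T^A T^B) = delta / 2. *)
pose v A := \tr (T A *m Y) *+ 2.
have evX : map_mx (meval v) (Xpoly T) = Y.
  apply/matrixP => i j; apply: (@mulIf F 3); first by rewrite pnatr_eq0.
  have /matrixP/(_ i j) := expandF Y; rewrite trY raddf0 subr0.
  rewrite !mulmxnE summxE => YE.
  transitivity ((\sum_A v A * T A i j) * 3).
    congr (_ * _); rewrite mxE /Xpoly summxE raddf_sum; apply: eq_bigr => A _.
    by rewrite /= !mxE mevalM /var mevalXU mevalC.
  rewrite !mulr_natr -YE -!sumrMnl; apply: eq_bigr => A _.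
  by rewrite mxE /v; ring.
have evq : meval v (quadp T) = 0.
  by rewrite /quadp -trace_map_mx map_mxM evX.
have evc : meval v (cubp T) = 3.
  by rewrite /cubp -trace_map_mx !map_mxM evX.
have evT B : map_mx (meval v) (Tpoly T B) = T B.
  by apply/matrixP => i j; rewrite !mxE mevalC.
pose M := if c1_index c m then Y else Y *m Y.
have evf B : meval v (fpoly T c m B) = \tr (T B *m M).
  rewrite /fpoly /M /upoly /vpoly; case: ifP => _;
    by rewrite -trace_map_mx !map_mxM evT evX.
have ev B : meval v (mode 0 B) = \tr (T B *m M) * 3 ^+ m.
  rewrite /modepoly big_ord_recl /= raddfD /= [X in _ + X]raddf_sum /= [X in _ + X]big1 => [|s _].
    rewrite rmorph1 scale1r addr0 /chain /invpoly subn0 add0n mix_shift0 expr0 mul1r.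
    by rewrite mevalM evf -evc rmorphXn.
  rewrite mevalZ /chain /invpoly !mevalM /= rmorphXn /= evq add0n expr0n.
  by rewrite eqn0Ngt mix_shift_gt0 // mul0r !mulr0.
apply: contrapT => none.
have M0 B : \tr (T B *m M) = 0.
  have : mode 0 B = 0 by apply/eqP; apply: contrapT => /negP nz; apply: none; exists B.
  move/(congr1 (meval v)); rewrite ev raddf0 => /eqP.
  by rewrite mulf_eq0 expf_eq0 pnatr_eq0 andbF orbF => /eqP.
have trM : \tr M = 0 by rewrite /M; case: ifP.
have := expandF M; rewrite trM raddf0 subr0 big1 => [|B _]; last by rewrite M0 scale0r.
rewrite mul0rn => /matrixP M3.
have Mij i j : M i j = 0.
  by have /esym/eqP := M3 i j; rewrite mulmxnE mxE -mulr_natr mulf_eq0 pnatr_eq0 orbF => /eqP.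
(* Entry (0, 1) of Y and entry (0, 2) of Y^2 are both 1. *)
have := Mij i0 i1; have := Mij i0 i2; rewrite /M; case: ifP => _.
  by move=> _; rewrite mxE /= => /eqP; rewrite oner_eq0.
rewrite !(mxE, sum3) /= !(mul0r, mulr0, mul1r, add0r, addr0) => /eqP.
by rewrite oner_eq0.
Qed.

End Waves.

(** * One-fermion states and the action of the Hamiltonian on them *)

Section OneFermion.
Variables (R : realType) (T : 'I_8 -> 'M[R[i]]_3).
Hypothesis tr0 : forall A, \tr (T A) = 0.
Hypothesis trT : forall A B, \tr (T A *m T B) = (A == B)%:R / 2.

Local Notation P := (mpoly 8 R[i]).

Implicit Types f g : 'I_8 -> P.

Lemma fockN G (p : P) : fock G (- p) = - fock G p.
Proof.
apply/funext => s; rewrite /fock fctE /= mcoeffN; ring.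
Qed.

Lemma hamiltonian_fock G (p : P) : hamiltonian T (fock G p) = fock G (hampoly T p).
Proof.
rewrite /hamiltonian tr2_aDa_fock // tr2_aDaD_fock tr2_aa_fock //.
apply/funext => s; rewrite !fctE /fock mcoeff_hampoly /GRing.scale /=.
by ring.
Qed.

Lemma fock1E f n (A : 'I_8) : fock1 f (n, [set A]) = occ_norm R n * mcoeff (occ_mnm n) (f A).
Proof.
rewrite /fock1 fct_sumE (bigD1 A) //= big1 => [|B BA]; last first.
  by rewrite /fock /= (inj_eq set1_inj) eq_sym (negPf BA) mul0r.
by rewrite /fock /= eqxx mul1r addr0.
Qed.

Lemma fock1_eq0 f (s : occ) : #|s.2| != 1%N -> fock1 f s = 0.
Proof.
move=> s1; rewrite /fock1 fct_sumE big1 // => A _.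
by rewrite /fock; case: eqP => [sA|]; rewrite ?mul0r //; move: s1; rewrite sA cards1.
Qed.

Lemma fock1_ext f g : (forall A, f A = g A) -> fock1 f = fock1 g.
Proof. by move=> fg; apply: eq_bigr => A _; rewrite fg. Qed.

Lemma fock1D f g : fock1 (fun A => f A + g A) = fock1 f + fock1 g.
Proof. by rewrite /fock1 -big_split; apply: eq_bigr => A _; rewrite fockD. Qed.

Lemma fock1N f : fock1 (fun A => - f A) = - fock1 f.
Proof. by rewrite /fock1 -sumrN; apply: eq_bigr => A _; rewrite fockN. Qed.

Lemma fock1Z a f : fock1 (fun A => a *: f A) = a *: fock1 f.
Proof. by rewrite /fock1 scaler_sumr; apply: eq_bigr => A _; rewrite fockZ. Qed.

Lemma fock1_sum (I : finType) (f : I -> 'I_8 -> P) :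
  fock1 (fun A => \sum_k f k A) = \sum_k fock1 (f k).
Proof.
rewrite /fock1 exchange_big; apply: eq_bigr => A _.
by rewrite fock_sum.
Qed.

(** H leaves the fermionic modes untouched. By locality, on a fixed fermion set the state may be
    replaced by its single component there, or by 0 if the set is not a singleton. *)
Lemma hamiltonian_fock1 f : hamiltonian T (fock1 f) = fock1 (fun A => hampoly T (f A)).
Proof.
apply/funext => -[n H].
have [/cards1P[A ->]|H1] := boolP (#|H| == 1%N).
  transitivity (hamiltonian T (fock [set A] (f A)) (n, [set A])).
    apply: local_hamiltonian => -[n' H'] /= -> _.
    by rewrite fock1E /fock /= eqxx mul1r.
  by rewrite hamiltonian_fock fock1E /fock /= eqxx mul1r.
rewrite fock1_eq0 //; transitivity (hamiltonian T (fock H 0) (n, H)).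
  apply: local_hamiltonian => -[n' H'] /= -> _.
  by rewrite fock1_eq0 // fock0.
by rewrite hamiltonian_fock /fock /= hampoly0 mcoeff0 !mulr0.
Qed.

End OneFermion.

(** * The four families *)

Definition fam_parity (fam : sol_family) : parity :=
  match fam with OddC1 | OddC2 => Odd | EvenC1 | EvenC2 => Even end.

Definition fam_top (fam : sol_family) (kappa : nat) : nat :=
  match fam with
  | OddC1 | EvenC2 => (2 * kappa)%N
  | OddC2 | EvenC1 => (2 * kappa).+1
  end.

Lemma lag_indexE fam kappa :
  lag_index fam kappa = mix_alpha (fam_parity fam) (fam_top fam kappa).
Proof. by case: fam; rewrite /mix_alpha /= oddM //=; lia. Qed.

Lemma lag_index_offset fam kappa :
  lag_index fam kappa = (6 * kappa + offset fam + 3)%N.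
Proof. by case: fam => /=; rewrite -addnA. Qed.

Lemma big_ord_pairs (V : nmodType) (a : nat -> V) k :
  \sum_(s < (2 * k).+1) a s =
  a 0%N + \sum_(1 <= p < k.+1) (a (2 * p).-1 + a (2 * p)%N).
Proof.
elim: k => [|k IH]; first by rewrite big_ord1 big_geq // addr0.
rewrite big_nat_recr // (_ : 2 * k.+1 = (2 * k).+2)%N; last by lia.
by rewrite addrA -IH big_ord_recr [in LHS]big_ord_recr /= addrA.
Qed.

Section ModeChain.
Variables (R : realType) (T : 'I_8 -> 'M[R[i]]_3).

Definition chain_ket c m n s : state R :=
  (if c1_index c (m - s) then C1 T else C2 T)
    (ket T (n + mix_shift c m s) (m - s)).

Let term c m n s := (mix_rec R c m s)%:C%C *: chain_ket c m n s.

Let termE c m n s y j : (s + y)%N = m -> j = (n + mix_shift c m s)%N ->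
  term c m n s =
  (Gamma R c m y)%:C%C *: (if c1_index c y then C1 T else C2 T) (ket T j y).
Proof.
move=> sy ->; rewrite /term /chain_ket /Gamma (_ : m - s = y)%N; last by lia.
by rewrite (_ : m - y = s)%N; last by lia.
Qed.

Let term0 c m n : term c m n 0 = (if c1_index c m then C1 T else C2 T) (ket T n m).
Proof.
by rewrite /term /chain_ket mix_shift0 addn0 subn0 [mix_rec _ _ _ _]/= scale1r.
Qed.

Let odd2B k p : odd (2 * k - 2 * p) = false.
Proof. by rewrite -mulnBr mul2n odd_double. Qed.

Let odd2 k : odd (2 * k) = false.
Proof. by rewrite mul2n odd_double. Qed.

(** The sums over p group the chain in consecutive pairs below the top. When the top index is odd
    one member stays unpaired. *)
Lemma mode_chain fam kappa n :
  let c := fam_parity fam in let m := fam_top fam kappa in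
  mode T fam kappa n =
  \sum_(s < m.+1) (mix_rec R c m s)%:C%C *: chain_ket c m n s.
Proof.
case: fam => c m; rewrite -[RHS]/(\sum_(s < m.+1) term c m n s) /mode.
- rewrite big_ord_pairs term0 /= odd2; congr (_ + _).
  apply: eq_big_nat => p /andP[p1 pk].
  rewrite (@termE c m n (2 * p).-1 (2 * kappa - 2 * p).+1 (n + 3 * p - 2)) /m /c /=; [|lia|].
    rewrite (@termE Odd _ n (2 * p) (2 * kappa - 2 * p) (n + 3 * p)) /=; [|lia|].
      by rewrite odd2B.
    by rewrite /mix_shift /= odd2; lia.
  by rewrite /mix_shift /= odd2; lia.
(* The unpaired member is the last one, with index 0. *)
- rewrite big_ord_recr /= big_ord_pairs term0 /= odd2; congr (_ + _ + _).
    apply: eq_big_nat => p /andP[p1 pk].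
    rewrite (@termE c m n (2 * p).-1 (2 * kappa - 2 * p).+2 (n + 3 * p - 1)) /m /c /=; [|lia|].
      rewrite (@termE Odd _ n (2 * p) (2 * kappa - 2 * p).+1 (n + 3 * p)) /=; [|lia|].
        by rewrite odd2B.
      by rewrite /mix_shift /= odd2; lia.
    by rewrite /mix_shift /= odd2; lia.
  have nE : (n + 3 * kappa + 2 = n + mix_shift Odd (2 * kappa).+1 (2 * kappa).+1)%N.
    by rewrite /mix_shift /= odd2; lia.
  by rewrite (@termE c m n _ 0 _ (addn0 _) nE).
(* The unpaired member is the one just below the top; the remaining pairs appear in reverse
   order. *)
- rewrite big_ord_recl /= term0 /= odd2 -addrA; congr (_ + _).
  rewrite /bump /=; under [RHS]eq_bigr do rewrite add1n.
  rewrite (big_ord_pairs (fun s => term c m n s.+1)); congr (_ + _).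
    have nE : (n.+1 = n + mix_shift Even (2 * kappa).+1 1)%N.
      by rewrite /mix_shift /= odd2; lia.
    by rewrite (@termE c m n 1 (2 * kappa) _ (add1n _) nE) /c /= odd2.
  apply: eq_big_nat => p /andP[p1 pk]; rewrite addrC.
  rewrite (@termE c m n (2 * p).-1.+1 (2 * kappa - 2 * p).+1 (n + 3 * p)) /m /c /=; [|lia|].
    rewrite (@termE Even _ n (2 * p).+1 (2 * kappa - 2 * p) (n + 3 * p + 1)) /=; [|lia|].
      by rewrite odd2B.
    by rewrite /mix_shift /= odd2; lia.
  by rewrite /mix_shift /= odd2; lia.
rewrite big_ord_pairs term0 /= odd2; congr (_ + _).
apply: eq_big_nat => p /andP[p1 pk].
rewrite (@termE c m n (2 * p).-1 (2 * kappa - 2 * p).+1 (n + 3 * p - 1)) /m /c /=; [|lia|].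
  rewrite (@termE Even _ n (2 * p) (2 * kappa - 2 * p) (n + 3 * p)) /=; [|lia|].
    by rewrite odd2B.
  by rewrite /mix_shift /= odd2; lia.
by rewrite /mix_shift /= odd2; lia.
Qed.

End ModeChain.

Section ModeStates.
Variables (R : realType) (T : 'I_8 -> 'M[R[i]]_3).
Hypothesis tr0 : forall A, \tr (T A) = 0.
Hypothesis trT : forall A B, \tr (T A *m T B) = (A == B)%:R / 2.
Variables (fam : sol_family) (kappa : nat).

Local Notation c := (fam_parity fam).
Local Notation m := (fam_top fam kappa).
Local Notation al := (lag_index fam kappa).
Local Notation phi := (real_complex R : {rmorphism R -> R[i]}).

Lemma chain_ket_fock1 n s : chain_ket T c m n s = fock1 (chain T c m n s).
Proof.
rewrite /chain_ket ket_fock /chain /fpoly.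
by case: (c1_index c (m - s)); rewrite ?C1_fock ?C2_fock.
Qed.

Lemma mode_fock1 n : mode T fam kappa n = fock1 (modepoly phi T c m n).
Proof.
rewrite mode_chain /modepoly fock1_sum; apply: eq_bigr => s _.
by rewrite fock1Z chain_ket_fock1.
Qed.

Definition wave E M : state R := \sum_(n < M) summand T fam kappa E n.

Lemma wave_fock1 E M : wave E M = fock1 (wavepoly phi T c m E M).
Proof.
rewrite /wave /wavepoly fock1_sum; apply: eq_bigr => n _.
by rewrite /summand fock1Z mode_fock1 lag_indexE.
Qed.

Lemma hamiltonian_wave (a : R[i]) E M :
  hamiltonian T (a *: wave E M.+1) = a *: (E%:C%C *: wave E M.+1
    + ((M.+1 * (M.+1 + al))%:R / 2 * (laguerre al M.+1 (2 * E))%:C%C) *: mode T fam kappa M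
    - ((laguerre al M (2 * E))%:C%C / 2) *: mode T fam kappa M.+1).
Proof.
rewrite wave_fock1 -fock1Z hamiltonian_fock1 // !mode_fock1.
rewrite -!fock1Z -fock1D -fock1N -fock1D -fock1Z.
apply: fock1_ext => B; rewrite hampolyZ lag_indexE; congr (_ *: _).
exact: hampoly_wavepoly.
Qed.

Lemma mode_eq0 n (s : occ) : (quanta s + 3 != 2 * n + al)%N -> mode T fam kappa n s = 0.
Proof.
case: s => k H ks; rewrite mode_fock1.
have [/cards1P[A ->]|H1] := boolP (#|H| == 1%N); last by rewrite fock1_eq0.
rewrite fock1E mcoeff_mode ?mulr0 // -lag_indexE.
suff -> : mdeg (occ_mnm k) = quanta (k, H) by [].
by rewrite mdegE; apply: eq_bigr => B _; rewrite occ_mnmE.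
Qed.

Lemma mode0_state_neq0 : exists s : occ, (quanta s + 3 = al)%N /\ mode T fam kappa 0 s != 0.
Proof.
have [B] := mode0_neq0 phi tr0 trT c m.
move=> /eqP nz.
have [k kn] : exists k, mcoeff k (modepoly phi T c m 0 B) != 0.
  apply: contrapT => none; apply: nz; apply/mpolyP => k; rewrite mcoeff0.
  by apply/eqP; apply: contrapT => /negP kn; apply: none; exists k.
pose n : {ffun 'I_8 -> nat} := [ffun A => k A].
have nk : occ_mnm n = k by apply/mnmP => A; rewrite occ_mnmE ffunE.
have n0 : mode T fam kappa 0 (n, [set B]) != 0.
  rewrite mode_fock1 fock1E nk mulf_neq0 // sqrtC_eq0 pnatr_eq0 -lt0n.
  by rewrite prodn_gt0 // => A; rewrite fact_gt0.
exists (n, [set B]); split=> //; apply/eqP; apply: contraNT n0 => n0.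
by rewrite mode_eq0.
Qed.

Lemma fermion_number_wave (a : R[i]) (psi : state R) :
  (forall s : occ, #|s.2| != 1%N -> psi s = 0) -> fermion_number (a *: psi) = a *: psi.
Proof.
move=> psi0; apply: fermion_number_singleton => s s1.
by rewrite fctE psi0 // scaler0.
Qed.

End ModeStates.

(** * Eigenstates at finite and at infinite cut-off *)

Section Solutions.
Variables (R : realType) (T : 'I_8 -> 'M[R[i]]_3).
Hypothesis tr0 : forall A, \tr (T A) = 0.
Hypothesis trT : forall A B, \tr (T A *m T B) = (A == B)%:R / 2.
Variables (fam : sol_family) (kappa : nat).

Local Notation al := (lag_index fam kappa).
Local Notation W := (wave T fam kappa).
Local Notation V := (mode T fam kappa).

Lemma prefactor_neq0 (E : R) : 0 < E -> (prefactor fam kappa E)%:C%C != 0.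
Proof.
move=> E0; rewrite fmorph_eq0 /prefactor lt0r_neq0 // mulr_gt0 ?expR_gt0 //.
by apply: powR_gt0; rewrite mulr_gt0.
Qed.

Lemma waveS E M s :
  W E M.+1 s = W E M s + (laguerre al M (2 * E))%:C%C * V M s.
Proof. by rewrite /wave big_ord_recr. Qed.

(** Mode n contains more than n quanta, so modes beyond [quanta s] contribute nothing at s. *)
Lemma wave_stable E M (s : occ) : (quanta s < M)%N -> W E M s = W E (quanta s).+1 s.
Proof.
move=> /subnKC <-; elim: (M - _)%N => [|k IH]; first by rewrite addn0.
rewrite addnS waveS IH mode_eq0 ?mulr0 ?addr0 //.
by rewrite lag_index_offset; lia.
Qed.

Lemma wave_lowest E M (s : occ) : (quanta s + 3 = al)%N ->
  W E M.+1 s = (laguerre al 0 (2 * E))%:C%C * V 0 s.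
Proof.
move=> sal; elim: M => [|M IH]; first by rewrite waveS /wave big_ord0 add0r.
rewrite waveS IH [V M.+1 s]mode_eq0 ?mulr0 ?addr0 // sal; lia.
Qed.

Lemma wave_support E M (s : occ) : #|s.2| != 1%N -> W E M s = 0.
Proof. by move=> s1; rewrite wave_fock1 fock1_eq0. Qed.

(** At the lowest particle number only mode 0 contributes, with L_0 a nonzero constant. *)
Lemma wave_lowest_neq0 E : exists s : occ, forall M, W E M.+1 s != 0.
Proof.
have [s [sal s0]] := mode0_state_neq0 tr0 trT fam kappa.
by exists s => M; rewrite wave_lowest // mulf_neq0 // fmorph_eq0 laguerre_at0_neq0.
Qed.

Lemma cutoff_solution (N : nat) (E : R) : (6 * kappa + offset fam <= N)%N ->
  laguerre al (range_size fam kappa N) (2 * E) = 0 ->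
  let psi := (prefactor fam kappa E)%:C%C *:
    \sum_(n < range_size fam kappa N) summand T fam kappa E n in
  [/\ 0 < E, fermion_number psi = psi & eigenstate (cutoff_hamiltonian T N) E psi].
Proof.
move=> Nge L0 psi.
have E0 : 0 < E by have := laguerre_root_gt0 L0; rewrite pmulr_rgt0.
(* M is the largest index for which mode M has at most N quanta; [range_size] is M + 1. *)
pose M := ((N - (6 * kappa + offset fam)) %/ 2)%N.
have psiE : psi = (prefactor fam kappa E)%:C%C *: W E M.+1 by [].
have psi_top s : (N < quanta s)%N -> psi s = 0.
  move=> Ns; rewrite psiE fctE /wave fct_sumE big1 ?scaler0 // => n _.
  rewrite /summand fctE mode_eq0 ?scaler0 // lag_index_offset.
  by have := ltn_ord n; rewrite /M; lia.
have projK : cutoff_proj N psi = psi.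
  apply/funext => s; rewrite /cutoff_proj; case: leqP => // Ns.
  by rewrite psi_top.
split=> //.
  by rewrite psiE; apply: fermion_number_wave => s s1; rewrite wave_support.
split.
  have [s s0] := wave_lowest_neq0 E.
  move/(congr1 (@^~ s)); rewrite psiE fctE => /eqP.
  by rewrite mulf_eq0 (negPf (s0 M)) orbF (negPf (prefactor_neq0 E0)).
apply/funext => s; rewrite /cutoff_hamiltonian /= projK /cutoff_proj; case: leqP => Ns; last first.
  by rewrite fctE psi_top // scaler0.
rewrite psiE hamiltonian_wave // (_ : laguerre al M.+1 (2 * E) = 0) //.
(* The surviving boundary mode has more than N quanta, hence no amplitude below the cut-off. *)
have top0 : V M.+1 s = 0 by rewrite mode_eq0 // lag_index_offset /M; lia.
rewrite rmorph0 mulr0 scale0r addr0 !fctE top0 scaler0 subr0.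
by rewrite /psi /GRing.scale /= mulrCA.
Qed.

Lemma continuum_solution (E : R) : 0 < E ->
  exists S : state R, sums_to (summand T fam kappa E) S /\
  let psi := (prefactor fam kappa E)%:C%C *: S in
  fermion_number psi = psi /\ eigenstate (hamiltonian T) E psi.
Proof.
move=> E0; pose S : state R := fun s => W E (quanta s).+1 s.
exists S; split; first by move=> s; exists (quanta s).+1 => M sM; exact: wave_stable.
move=> psi; split.
  by apply: fermion_number_wave => s s1; rewrite /S wave_support.
split.
  have [s s0] := wave_lowest_neq0 E.
  move/(congr1 (@^~ s)); rewrite /psi fctE => /eqP.
  by rewrite mulf_eq0 (negPf (s0 _)) orbF (negPf (prefactor_neq0 E0)).
apply/funext => s.
(* H at s sees at most two quanta more, so this partial sum is already exact there; both boundary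
   modes have too many quanta to reach s. *)
transitivity (hamiltonian T ((prefactor fam kappa E)%:C%C *: W E (quanta s + 2).+1) s).
  apply: local_hamiltonian => s' _ s's; rewrite /psi !fctE /S; congr (_ *: _).
  by rewrite [RHS]wave_stable // ltnS.
have top0 n : (quanta s < n)%N -> V n s = 0.
  by move=> sn; rewrite mode_eq0 // lag_index_offset; lia.
rewrite hamiltonian_wave // !fctE !top0 ?scaler0 ?subr0 ?addr0; [|lia..].
rewrite wave_stable; last by lia.
by rewrite /psi !fctE /S /GRing.scale /= mulrCA.
Qed.

Lemma quantized_energies_dense (E eps : R) : 0 < E -> 0 < eps ->
  exists N0 : nat, forall N : nat, (N0 <= N)%N ->
  exists E' : R, `|E' - E| < eps /\
    laguerre al (range_size fam kappa N) (2 * E') = 0.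
Proof.
move=> E0 e0.
(* The polynomials are evaluated at twice the energy, so position and tolerance are doubled. *)
have [n0 dense] := @laguerre_root_dense R al (2 * E) (2 * eps) ltac:(lra) ltac:(lra).
exists (2 * n0 + (6 * kappa + offset fam))%N => N N0N.
have [|y ylt Ly] := dense (range_size fam kappa N); first by rewrite /range_size; lia.
exists (y / 2); split; last by rewrite mulrCA mulfV ?mulr1 ?pnatr_eq0.
by move: ylt; rewrite !ltr_norml => /andP[? ?]; apply/andP; split; lra.
Qed.

End Solutions.

Theorem mainTheorem5 (R : realType) (T : 'I_8 -> 'M[R[i]]_3)
    (hT : su3_generators T) :
  (forall (fam : sol_family) (kappa : nat),
    [/\ (* the finite cut-off solutions *)
        forall (N : nat) (E : R), (6 * kappa + offset fam <= N)%N ->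
          laguerre (lag_index fam kappa) (range_size fam kappa N) (2 * E) = 0 ->
          let psi := (prefactor fam kappa E)%:C%C *:
            \sum_(n < range_size fam kappa N) summand T fam kappa E n in
          [/\ 0 < E, fermion_number psi = psi &
              eigenstate (cutoff_hamiltonian T N) E psi],
        (* the continuum solutions *)
        forall E : R, 0 < E ->
          exists S : state R, sums_to (summand T fam kappa E) S /\
          let psi := (prefactor fam kappa E)%:C%C *: S in
          fermion_number psi = psi /\ eigenstate (hamiltonian T) E psi &
        (* the solutions of the quantization conditions fill the positive axis *)
        forall E eps : R, 0 < E -> 0 < eps ->
          exists N0 : nat, forall N : nat, (N0 <= N)%N ->
          exists E' : R, `|E' - E| < eps /\
            laguerre (lag_index fam kappa) (range_size fam kappa N) (2 * E') = 0])
  /\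
  (forall E : R, 0 < E ->
    (exists S : state R,
      sums_to (fun n => (laguerre 4 n (2 * E))%:C%C *: C1 T (ket T n 0)) S /\
      let psi := ((2 * E) `^ (1 / 2) * expR (- E))%:C%C *: S in
      fermion_number psi = psi /\ eigenstate (hamiltonian T) E psi) /\
    (exists S : state R,
      sums_to (fun n => (laguerre 5 n (2 * E))%:C%C *: C2 T (ket T n 0)) S /\
      let psi := (2 * E * expR (- E))%:C%C *: S in
      fermion_number psi = psi /\ eigenstate (hamiltonian T) E psi)).
Proof.
have [_ tr0 trT] := hT; split=> [fam kappa|E E0]; first split.
- by move=> N E; exact: cutoff_solution.
- exact: continuum_solution.
- exact: quantized_energies_dense.
split.
  (* For kappa = 0 the sum over p is empty and only the unmixed term remains. *)
  have [S [sumS solS]] := continuum_solution tr0 trT OddC1 0 E0.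
  exists S; split.
    move=> s; have [M0 M0S] := sumS s; exists M0 => M /M0S <-.
    by congr (_ s); apply: eq_bigr => n _; rewrite /summand /mode big_geq // addr0.
  by move: solS; rewrite /prefactor mulr0 add0r.
have [S [sumS solS]] := continuum_solution tr0 trT EvenC2 0 E0.
exists S; split.
  move=> s; have [M0 M0S] := sumS s; exists M0 => M /M0S <-.
  by congr (_ s); apply: eq_bigr => n _; rewrite /summand /mode big_geq // addr0.
by move: solS; rewrite /prefactor mulr0 add0r powRr1 // mulr_ge0 // ltW.
Qed.
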